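(* The Riemannian manifold $({\rm M}_1,\gamma)$ has finite volume and finite diameter.
   Context: ${\rm M}_1$ is the (noncompact, 6-dimensional) space of degree one rational maps $W(z)=\frac{az+b}{cz+d}$, $ad-bc\neq0$, of the Riemann sphere, i.e. $PL(2,\mathbb{C})$. $\gamma$ is the $L^2$ metric: for a tangent vector represented by a variation $\dot W$, $\gamma(\dot W,\dot W)=\int_{\mathbb{C}}\frac{2\,dx\,dy}{(1+|z|^2)^2}\frac{|\dot W|^2}{(1+|W|^2)^2}$, $z=x+iy$ (stereographic coordinates $z,W$ on domain and codomain spheres). *)

(* Defs.v *)
From HB Require Import structures.
From mathcomp Require Import all_boot all_order all_algebra.
From mathcomp Require Import all_classical all_reals all_analysis.
Set Implicit Arguments. Unset Strict Implicit. Unset Printing Implicit Defensive.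
Import Order.TTheory GRing.Theory Num.Theory.
Import numFieldNormedType.Exports.
Local Open Scope classical_set_scope.
Local Open Scope ring_scope.

Section M1.
Variable R : realType.

Definition cplx := (R * R)%type.
Definition cadd (x y : cplx) : cplx := (x.1 + y.1, x.2 + y.2).
Definition csub (x y : cplx) : cplx := (x.1 - y.1, x.2 - y.2).
Definition cmul (x y : cplx) : cplx :=
  (x.1 * y.1 - x.2 * y.2, x.1 * y.2 + x.2 * y.1).
Definition cnorm2 (x : cplx) : R := x.1 ^+ 2 + x.2 ^+ 2.
Definition cdot (x y : cplx) : R := x.1 * y.1 + x.2 * y.2.

(* A quadruple (a,b,c,d) of complex numbers, representing W(z)=(az+b)/(cz+d). *)
Definition quad := (cplx * cplx * cplx * cplx)%type.
Definition qa (q : quad) : cplx := q.1.1.1.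
Definition qb (q : quad) : cplx := q.1.1.2.
Definition qc (q : quad) : cplx := q.1.2.
Definition qd (q : quad) : cplx := q.2.

Definition nondeg (q : quad) : Prop :=
  csub (cmul (qa q) (qd q)) (cmul (qb q) (qc q)) <> (0, 0).

(* Lebesgue measure on C = R^2 (stereographic coordinate z = x + iy). *)
Definition leb2 := ((@lebesgue_measure R) \x (@lebesgue_measure R))%E.

(* Fubini--Study density 2 / (1+|z|^2)^2 on the domain sphere. *)
Definition rho (z : cplx) : R := 2 / (1 + cnorm2 z) ^+ 2.

(* For W = (az+b)/(cz+d) and a variation u = (a',b',c',d') of (a,b,c,d),
   Wdot = Nv q u z / (cz+d)^2 with
   Nv q u z = (a'z+b')(cz+d) - (az+b)(c'z+d'). *)
Definition Nv (q u : quad) (z : cplx) : cplx :=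
  csub (cmul (cadd (cmul (qa u) z) (qb u)) (cadd (cmul (qc q) z) (qd q)))
       (cmul (cadd (cmul (qa q) z) (qb q)) (cadd (cmul (qc u) z) (qd u))).

(* |cz+d|^2 + |az+b|^2; then |Wdot|^2/(1+|W|^2)^2 = |Nv|^2 / Den^2
   (and Re(Wdot_u conj Wdot_v)/(1+|W|^2)^2 = cdot (Nv u) (Nv v) / Den^2). *)
Definition Den (q : quad) (z : cplx) : R :=
  cnorm2 (cadd (cmul (qa q) z) (qb q)) + cnorm2 (cadd (cmul (qc q) z) (qd q)).

(* The L^2 metric gamma (polarized, i.e. the real inner product
   Re \int ...) at the point [q] of M_1, evaluated on the tangent vectors
   induced by the variations u, v of (a,b,c,d). *)
Definition gammaL2 (q u v : quad) : R :=
  Rintegral leb2 setT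
    (fun z => rho z * (cdot (Nv q u z) (Nv q v z) / Den q z ^+ 2)).

(* Chart on the open dense subset {d <> 0} of M_1 (normalize d = 1):
   real coordinates ((a, b), c) in C^3 = R^6.  Its complement {d = 0} has
   real codimension 2, hence Riemannian measure zero. *)
Definition chart (x : cplx * cplx * cplx) : quad := (x.1.1, x.1.2, x.2, (1, 0)).

Definition coorddir (k : 'I_6) : quad :=
  let e (j : nat) : cplx :=
    ((if k == (2 * j)%N :> nat then 1 else 0),
     (if k == (2 * j).+1 :> nat then 1 else 0)) in
  (e 0%N, e 1%N, e 2%N, (0, 0)).

Definition gram (x : cplx * cplx * cplx) : 'M[R]_6 :=
  \matrix_(i, j) gammaL2 (chart x) (coorddir i) (coorddir j).

Definition voldens (x : cplx * cplx * cplx) : R :=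
  if `[< nondeg (chart x) >] then Num.sqrt (\det (gram x)) else 0.

Definition leb6 := ((leb2 \x leb2) \x leb2)%E.

Definition volume_M1 : \bar R := (\int[leb6]_x (voldens x)%:E)%E.

(* Curves in M_1 are represented by lifts t |-> (a(t),b(t),c(t),d(t)),
   encoded as C^1 maps R -> R^8, restricted to [0,1]. *)
Definition quad_of (v : 'rV[R]_8) : quad :=
  ((v ord0 (inord 0), v ord0 (inord 1)), (v ord0 (inord 2), v ord0 (inord 3)),
   (v ord0 (inord 4), v ord0 (inord 5)), (v ord0 (inord 6), v ord0 (inord 7))).

Definition C1_curve (f : R -> 'rV[R]_8) : Prop :=
  (forall t, derivable f t 1) /\ continuous (derive1 f).

Definition curve_length (f : R -> 'rV[R]_8) : \bar R :=
  (\int[@lebesgue_measure R]_(t in `[0%R, 1%R]%classic)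
     (Num.sqrt (gammaL2 (quad_of (f t)) (quad_of (derive1 f t))
                        (quad_of (derive1 f t))))%:E)%E.

Definition joinable_within (D : R) (p q : quad) : Prop :=
  exists f : R -> 'rV[R]_8,
    [/\ C1_curve f, quad_of (f 0) = p, quad_of (f 1) = q,
        (forall t, 0 <= t <= 1 -> nondeg (quad_of (f t)))
      & (curve_length f <= D%:E)%E].

Definition finite_diameter_M1 : Prop :=
  exists D : R, forall p q : quad, nondeg p -> nondeg q -> joinable_within D p q.

End M1.

(* Main.v *)
(** Represent W by a 2x2 matrix q and write Z = (z, 1), so that Den = |q Z|^2.
    Cauchy-Schwarz bounds gamma_q(u, u) by |u|^2 times the integral of
    2 / ((1 + |z|^2) |q Z|^2).  By Lagrange's identity, al |q Z|^2 is
    |al z + k|^2 + |det q|^2, where al is the squared norm of the first column,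
    and there is a similar formula for the second column; interpolating between
    the two terms gives, for 0 < s <= 1/2,
      gamma_q(u, u) <= C_s |u|^2 |q|^(4s - 2) |det q|^(-2s).

    Volume: apply Hadamard's inequality to the Gram matrix after replacing one
    coordinate direction by the radial one.  As gamma_q(q, q) = 0, the radial
    direction in the chart d = 1 acts as a unit vector, which gains the factor
    |q|^(-1) needed to make the bound integrable (with s = 1/18).

    Diameter: up to a complex scalar, q = h + i k with quaternions |h| = 1 and
    |k| <= 1, and Re (det q) = |h|^2 - |k|^2.  After a change of sign,
    two points have <h0, h1> >= 0, and the path (1-t) h0 + t h1 + i ((1-t)^2 k0 + t^2 k1) satisfies
    Re det >= t (1-t), so by the bound with s = 1/2 its speed is
    O((t (1-t))^(-1/2)), uniformly in the endpoints. *)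

Require Import Defs.
From HB Require Import structures.
From mathcomp Require Import all_boot all_order all_algebra.
From mathcomp Require Import all_classical all_reals all_analysis.
From mathcomp Require Import measurable_realfun ring lra.
Set Implicit Arguments. Unset Strict Implicit. Unset Printing Implicit Defensive.
Import Order.TTheory GRing.Theory Num.Theory.
Import numFieldNormedType.Exports.
Local Open Scope classical_set_scope.
Local Open Scope ring_scope.

(** * A one-dimensional singular kernel *)

(** On nonnegative reals inversion is the real power of exponent -1, including at 0, where both take
    the value 0. *)
Lemma measurable_inv_ge0 d (T : measurableType d) (R : realType) (D : set T)
    (f : T -> R) :
  (forall x, 0 <= f x) -> measurable_fun D f -> measurable_fun D (fun x => (f x)^-1).
Proof.
move=> f0 mf; rewrite (_ : (fun _ => _) = (fun x => (f x) `^ (- 1))).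
  by apply: (measurableT_comp (measurable_powR _)).
by apply/funext => x; rewrite powR_inv1.
Qed.

Section OneDim.
Variable R : realType.
Implicit Types (s c x e : R).
Let mu := @lebesgue_measure R.

(** For x > 0 this is the derivative of -1/(1 + x^s). It behaves like |x|^(s-1) at 0 and like
    |x|^(-s-1) at infinity, and for s > 0 its mass on each half-line is 1, whatever s. *)
Definition kern s x : R := s * `|x| `^ (s - 1) / (1 + `|x| `^ s) ^+ 2.

Lemma kern_ge0 s x : 0 < s -> 0 <= kern s x.
Proof.
by move=> s0; rewrite /kern divr_ge0 ?mulr_ge0 ?powR_ge0 ?sqr_ge0// ltW.
Qed.

Lemma kernN s x : kern s (- x) = kern s x.
Proof. by rewrite /kern normrN. Qed.

Lemma measurable_kern s : measurable_fun [set: R] (kern s).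
Proof.
have mp t : measurable_fun [set: R] (fun x : R => `|x| `^ t).
  by apply: (measurableT_comp (measurable_powR _)).
rewrite /kern; apply: measurable_funM; first exact: measurable_funM.
apply: measurable_inv_ge0 => [x|]; first exact: sqr_ge0.
by apply: measurable_funX; apply: measurable_funD.
Qed.

Lemma is_derive_kern s x : 0 < x ->
  is_derive x 1 (fun y => - (1 + y `^ s)^-1) (kern s x).
Proof.
move=> x0; have dx := is_derive1_powR s x0.
have n0 : 1 + x `^ s != 0 by rewrite gt_eqF// ltr_pwDl// powR_ge0.
apply: is_derive_eq.
rewrite /kern gtr0_norm// add0r /GRing.scale/= mul1r mulNr opprK mulrC.
by [].
Qed.

Lemma continuous_kern s x : 0 < x -> {for x, continuous (kern s)}.
Proof.
move=> x0.
have cn : (fun y : R => `|y|) y @[y --> x] --> `|x| by apply: cvg_norm.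
have cp t : {for x, continuous (fun y : R => `|y| `^ t)}.
  apply: (@continuous_comp _ _ _ (fun y : R => `|y|) (fun y => y `^ t)) => //.
  apply/differentiable_continuous/derivable1_diffP/derivable_powR.
  by rewrite in_itv/= andbT normr_gt0 gt_eqF.
apply: cvgM; first by apply: cvgM; [exact: cvg_cst|exact: cp].
apply: (@continuousV _ _ (fun y : R => (1 + `|y| `^ s) ^+ 2)).
  by rewrite expf_neq0// gt_eqF// ltr_pwDl// powR_ge0.
have c1 : (1 + `|y| `^ s) @[y --> x] --> 1 + `|x| `^ s.
  by apply: cvgD; [exact: cvg_cst|exact: cp].
exact: (cvgM c1 c1).
Qed.

Let primitive_cvg s c : 0 < s ->
  - (1 + (x - c) `^ s)^-1 @[x --> +oo] --> (0 : R).
Proof.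
move=> s0.
rewrite -oppr0; apply: cvgN.
apply/cvgrPdist_le => /= e e0.
near=> x.
have xc : 0 < x - c.
  by rewrite subr_gt0; near: x; exact: (nbhs_pinfty_gt (num_real _)).
have p0 : 0 < (x - c) `^ s by exact: powR_gt0.
rewrite sub0r normrN ger0_norm ?invr_ge0 ?addr_ge0 ?(ltW p0)//.
rewrite -[e]invrK lef_pV2 ?posrE ?invr_gt0 ?ltr_pwDl ?(ltW p0)//.
rewrite -[leLHS](@powRr1 _ e^-1) ?invr_ge0 ?(ltW e0)//.
(* The threshold for [x - c] is (1/e)^(1/s). *)
rewrite -[X in _ `^ X <= _](mulVf (lt0r_neq0 s0)) powRrM.
apply: le_trans (_ : (x - c) `^ s <= _); last by rewrite lerDr.
apply: ge0_ler_powR => //; rewrite ?nnegrE ?powR_ge0 ?(ltW xc) ?(ltW s0)//.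
rewrite lerBrDr; near: x; exact: (nbhs_pinfty_ge (num_real _)).
Unshelve. all: by end_near. Qed.

(** The fundamental theorem of calculus gives the exact value 1/(1 + e^s). *)
Let int_right s c e : 0 < s -> 0 < e ->
  (\int[mu]_(x in `[(c + e)%R, +oo[) (kern s (x - c))%:E <= 1)%E.
Proof.
move=> s0 e0.
have xce x : c + e <= x -> 0 < x - c.
  by move=> h; rewrite subr_gt0 (lt_le_trans _ h)// ltrDl.
have dF x : 0 < x - c ->
    is_derive x 1 (fun x => - (1 + (x - c) `^ s)^-1) (kern s (x - c)).
  move=> xc; rewrite -[X in is_derive _ _ _ X]mulr1.
  apply: (@is_derive1_comp _ (fun y => - (1 + y `^ s)^-1) (fun x => x - c)).
    exact: is_derive_kern.
  exact: is_derive_shift.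
have cF x : 0 < x - c -> {for x, continuous (fun x => kern s (x - c))}.
  move=> xc; apply: (@continuous_comp _ _ _ (fun x => x - c) (kern s)).
    by apply: cvgB => //; exact: cvg_cst.
  exact: continuous_kern.
rewrite (@ge0_continuous_FTC2y _ _ (fun x => - (1 + (x - c) `^ s)^-1) _ 0).
- rewrite -EFinB sub0r opprK lee_fin invf_le1 ?lerDl ?powR_ge0//.
  by rewrite ltr_pwDl// powR_ge0.
- by move=> x _; exact: kern_ge0.
- apply/continuous_within_itvcyP; split => [x|].
    by rewrite in_itv/= andbT => /ltW/xce; exact: cF.
  by apply: cvg_at_right_filter; apply: cF; exact: xce.
- exact: primitive_cvg.
- by move=> x /ltW/xce/dF h; exact: ex_derive.
- apply: cvg_at_right_filter.
  have h := dF _ (xce _ (lexx _)).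
  have /derivable1_diffP/differentiable_continuous :
    derivable (fun x => - (1 + (x - c) `^ s)^-1) (c + e) 1 by exact: ex_derive.
  exact.
- move=> x; rewrite in_itv/= andbT => /ltW/xce/dF h.
  by rewrite derive1E; exact: derive_val.
Qed.

(** Since [kern] is even, the reflection x -> -x reduces this to [int_right] with centre [- c]. *)
Let int_left s c e : 0 < s -> 0 < e ->
  (\int[mu]_(x in `]-oo, (c - e)%R]) (kern s (x - c))%:E <= 1)%E.
Proof.
move=> s0 e0.
have -> : c - e = - ((- c) + e) by rewrite opprD opprK.
rewrite ge0_integration_by_substitutionNy; last 2 first.
- have cG x : x <= - (- c + e) -> {for x, continuous (fun x => kern s (x - c))}.
    move=> xc.
    rewrite (_ : (fun x => kern s (x - c)) = (fun x => kern s (c - x))); last first.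
      by apply/funext => y; rewrite -kernN opprB.
    apply: (@continuous_comp _ _ _ (fun x => c - x) (kern s)).
      by apply: cvgB => //; exact: cvg_cst.
    by apply: continuous_kern; move: xc e0; lra.
  apply/continuous_within_itvNycP; split => [x|].
    by rewrite in_itv/= => /ltW/cG.
  by apply: cvg_at_left_filter; exact: cG.
- by move=> x _; exact: kern_ge0.
apply: le_trans (int_right (- c) s0 e0).
rewrite le_eqVlt; apply/orP; left; apply/eqP; apply: eq_integral => x _ /=.
by rewrite -kernN opprD opprK opprK.
Qed.

(** The fundamental theorem does not apply across the singularity at [c]. Removing intervals of
    radius 1/(n+1) around it leaves two half-lines of mass at most 1 each, and monotone convergence
    recovers the line minus the null set {c}. *)
Lemma kern_integral s c : 0 < s ->
  (\int[mu]_x (kern s (x - c))%:E <= 2%:E)%E.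
Proof.
move=> s0.
pose F (n : nat) : set R := `]-oo, (c - n.+1%:R^-1)%R] `|` `[(c + n.+1%:R^-1)%R, +oo[.
have m1 : measurable_fun [set: R] (fun x => (kern s (x - c))%:E).
  apply/measurable_EFinP; apply: (measurableT_comp (measurable_kern s)).
  by apply: measurable_funB.
have mF n : measurable (F n) by apply: measurableU; exact: measurable_itv.
have UF : \bigcup_n F n = [set: R] `\ c.
  apply/seteqP; split => x /=.
    move=> [n _]; rewrite /F/= !in_itv/= andbT => h; split => // xc.
    have : 0 < n.+1%:R^-1 :> R by rewrite invr_gt0.
    by move: h; rewrite xc; move: (n.+1%:R^-1 : R) => e; lra.
  move=> [_ /eqP xc].
  have d0 : 0 < `|x - c| by rewrite normr_gt0 subr_eq0.
  have [n hn] : exists n, n.+1%:R^-1 < `|x - c|.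
    have [n hn] := ltr_add_invr (d0); exists n.
    by rewrite add0r in hn.
  exists n => //; rewrite /F/= !in_itv/= andbT.
  move: (n.+1%:R^-1 : R) hn => e.
  by case: (ler0P (x - c)) => ? ?; [left|right]; lra.
rewrite -(@integral_setD1 _ _ c) //; last 2 first.
- by rewrite -UF; exact: bigcup_measurable.
- exact: (measurable_funS measurableT).
rewrite -UF.
have nF : {homo F : n m / (n <= m)%N >-> (n <= m)%O}.
  move=> n m nm; rewrite subsetEset => x; rewrite /F/= !in_itv/= !andbT.
  have : m.+1%:R^-1 <= n.+1%:R^-1 :> R by rewrite lef_pV2 ?posrE ?ler_nat.
  move: (m.+1%:R^-1 : R) (n.+1%:R^-1 : R) => e e'.
  by move=> h [?|?]; [left|right]; lra.
have cvgF : (\int[mu]_(x in F n) (kern s (x - c))%:E)%E @[n --> \oo] -->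
    (\int[mu]_(x in \bigcup_n F n) (kern s (x - c))%:E)%E.
  apply: ge0_nondecreasing_set_cvg_integral => // [i|i x _].
    exact: (measurable_funS measurableT).
  by rewrite lee_fin kern_ge0.
apply: (@closed_cvg _ _ \oo _ (fun i => \int[mu]_(x in F i) (kern s (x - c))%:E)%E
   (fun y => (y <= 2%:E)%E)); last first.
- exact: cvgF.
- near=> n.
  rewrite ge0_integral_setU//=; last 3 first.
  + exact: (measurable_funS measurableT).
  + by move=> x _; rewrite lee_fin kern_ge0.
  + apply/disj_setPS => x /=; rewrite !in_itv/= andbT => -[].
    have : 0 < n.+1%:R^-1 :> R by rewrite invr_gt0.
    by move: (n.+1%:R^-1 : R) => e; lra.
  have -> : 2%:E = (1 + 1 :> \bar R)%E by rewrite -EFinD.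
  by apply: leeD; [apply: int_left|apply: int_right]; rewrite ?invr_gt0.
- exact: closed_ereal_ge_ereal.
Unshelve. all: by end_near. Qed.
End OneDim.

(** * Interpolation inequalities *)

Section PowerInequalities.
Variable R : realType.
Implicit Types (s t x y M N : R).

Lemma powRD_gt0 x s t : 0 < x -> x `^ (s + t) = x `^ s * x `^ t.
Proof. by move=> x0; rewrite powRD// (gt_eqF x0) implybT. Qed.

Lemma powRNn_le x y t : 0 < x -> x <= y -> t <= 0 -> y `^ t <= x `^ t.
Proof.
move=> x0 xy t0; have y0 := lt_le_trans x0 xy.
rewrite -[t]opprK !(powRN _ (- t)) lef_pV2 ?posrE ?powR_gt0//.
by apply: ge0_ler_powR; rewrite ?nnegrE ?oppr_ge0// ltW.
Qed.

(** Split (x + y)^(-1) as (x + y)^(s-1) (x + y)^(-s); both exponents are negative, so one summand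
    may be dropped in each factor. *)
Lemma powR_interpol x y s : 0 < s < 1 -> 0 < x -> 0 < y ->
  (x + y)^-1 <= x `^ (s - 1) * y `^ (- s).
Proof.
move=> /andP[s0 s1] x0 y0.
have E (z : R) : 0 < z -> z^-1 = z `^ (s - 1) * z `^ (- s).
  move=> z0; rewrite -powRD_gt0// (_ : s - 1 - s = -1); last by lra.
  by rewrite powR_inv1// ltW.
rewrite E ?addr_gt0//; apply: ler_pM; rewrite ?powR_ge0//.
  by apply: powRNn_le; rewrite ?lerDl ?(ltW y0)//; lra.
by apply: powRNn_le; rewrite ?lerDr ?(ltW x0)//; lra.
Qed.

(** For t = |z|^2 this is of order |z|^(2s-2) at 0 and |z|^(-2s-2) at infinity, hence integrable
    over the plane at both ends. *)
Definition shell s t : R := t `^ (s - 1) * (1 + t) `^ (- (2 * s)).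

Lemma shell_ge0 s t : 0 <= shell s t.
Proof. by rewrite mulr_ge0 ?powR_ge0. Qed.

Lemma bracket_le_shell s t : 0 < s <= 1 / 2 -> 0 < t ->
  (1 + t) `^ (- (1 + s)) <= shell s t.
Proof.
move=> /andP[s0 s1] t0; have t1 : 0 < 1 + t by lra.
have -> : - (1 + s) = (s - 1) + - (2 * s) by lra.
rewrite powRD_gt0// ler_wpM2r ?powR_ge0//.
by apply: powRNn_le => //; lra.
Qed.

(** If M <= 1 + N then 1 + N >= (1 + M)/2, and the lost factor 2^(2s) is at most 2 because s <= 1/2.
    Otherwise M^(s-1) <= (1 + N)^(s-1), and the left side is at most (1 + N)^(-(1+s)). This
    decouples two singularities with different centres. *)
Lemma mixed_le_shell s M N : 0 < s <= 1 / 2 -> 0 < M -> 0 < N ->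
  (1 + N) `^ (- (2 * s)) * M `^ (s - 1) <= 2 * shell s M + shell s N.
Proof.
move=> hs M0 N0; have /andP[s0 s1] := hs.
have N1 : 0 < 1 + N by lra.
have [MN|NM] := leP M (1 + N).
  apply: (@le_trans _ _ (2 * shell s M)); last by rewrite lerDl shell_ge0.
  rewrite /shell mulrCA mulrC ler_wpM2l ?powR_ge0//.
  apply: (@le_trans _ _ ((2^-1 * (1 + M)) `^ (- (2 * s)))).
    by apply: powRNn_le; lra.
  rewrite powRM ?invr_ge0//; last by lra.
  rewrite ler_wpM2r ?powR_ge0// -powR_inv1// -powRrM mulN1r opprK.
  rewrite -[leRHS]powRr1//; apply: ler_powR; lra.
apply: (@le_trans _ _ (shell s N)); last by rewrite lerDr mulr_ge0 ?shell_ge0.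
apply: le_trans (bracket_le_shell hs N0).
have -> : - (1 + s) = - (2 * s) + (s - 1) by lra.
rewrite [leRHS]powRD_gt0// ler_wpM2l ?powR_ge0//.
by apply: powRNn_le => //; lra.
Qed.

Lemma inv_le_powR N t : 0 < N -> t <= 1 -> (1 + N)^-1 <= (1 + N) `^ (- t).
Proof.
move=> N0 t1; rewrite -powR_inv1; last by lra.
by apply: ler_powR; lra.
Qed.

Lemma powR_div_le_shell s N : 0 < s <= 1 / 2 -> 0 < N ->
  N `^ (- s) / (1 + N) <= shell s N.
Proof.
move=> /andP[s0 s1] N0; have N1 : 0 < 1 + N by lra.
rewrite /shell (_ : - (2 * s) = (1 - 2 * s) + -1); last by lra.
rewrite (_ : - s = (s - 1) + (1 - 2 * s)); last by lra.
rewrite powRD_gt0// -mulrA ler_wpM2l ?powR_ge0//.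
rewrite [leRHS]powRD_gt0// powR_inv1; last by lra.
rewrite ler_wpM2r ?invr_ge0; [by []|by lra|].
by apply: ge0_ler_powR; rewrite ?nnegrE; lra.
Qed.

(** Both factors separate: |x||y| <= x^2 + y^2 for the singular one, and 1 + x^2 + y^2 dominates
    both 1 + x^2 and 1 + y^2 for the decaying one. Each one-variable factor is compared with [kern]
    through 1 + |z|^s <= 2 (1 + z^2)^(s/2). *)
Lemma shell_le_kern s x y : 0 < s <= 1 / 2 -> x != 0 -> y != 0 ->
  shell s (x ^+ 2 + y ^+ 2) <= 16 / s ^+ 2 * (kern s x * kern s y).
Proof.
move=> /andP[s0 s1] x0 y0.
have K (z : R) : z != 0 -> `|z| `^ (s - 1) * (1 + z ^+ 2) `^ (- s) <= 4 / s * kern s z.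
  move=> z0; have nz : 0 < `|z| by rewrite normr_gt0.
  have n2 : 0 <= z ^+ 2 by exact: sqr_ge0.
  have p0 : 0 < 1 + `|z| `^ s by rewrite ltr_pwDl ?powR_ge0.
  rewrite /kern (_ : 4 / s * _ = `|z| `^ (s - 1) * (4 / (1 + `|z| `^ s) ^+ 2)); last first.
    by field; rewrite !gt_eqF.
  rewrite ler_wpM2l ?powR_ge0// powRN.
  rewrite -[leRHS]invrK lef_pV2 ?posrE ?powR_gt0 ?invr_gt0 ?divr_gt0 ?exprn_gt0//; last lra.
  rewrite invf_div ler_pdivrMr// mulrC.
  have h : 1 + `|z| `^ s <= 2 * (1 + z ^+ 2) `^ (s / 2).
    have -> : `|z| `^ s = (z ^+ 2) `^ (s / 2).
      rewrite -real_normK ?num_real// -powR_mulrn// -powRrM.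
      by congr (_ `^ _); field.
    rewrite (_ : 2 * _ = (1 + z ^+ 2) `^ (s / 2) + (1 + z ^+ 2) `^ (s / 2)); last by ring.
    apply: lerD.
      by rewrite -[leLHS](powRr0 (1 + z ^+ 2)); apply: ler_powR; lra.
    by apply: ge0_ler_powR; rewrite ?nnegrE; lra.
  have -> : 4 * (1 + z ^+ 2) `^ s = (2 * (1 + z ^+ 2) `^ (s / 2)) ^+ 2.
    rewrite exprMn -[X in _ = _ * X]powR_mulrn ?powR_ge0// -powRrM.
    rewrite (_ : s / 2 * 2%:R = s); last by field.
    by congr (_ * _); lra.
  by rewrite ler_pXn2r ?nnegrE ?mulr_ge0 ?powR_ge0// ltW.
have nx : 0 < `|x| by rewrite normr_gt0.
have ny : 0 < `|y| by rewrite normr_gt0.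
have x2 : x ^+ 2 = `|x| ^+ 2 by rewrite real_normK ?num_real.
have y2 : y ^+ 2 = `|y| ^+ 2 by rewrite real_normK ?num_real.
have -> : 16 / s ^+ 2 * (kern s x * kern s y) =
   (4 / s * kern s x) * (4 / s * kern s y) by field; rewrite gt_eqF.
apply: le_trans (ler_pM _ _ (K x x0) (K y y0)); rewrite ?mulr_ge0 ?powR_ge0//.
rewrite mulrACA; apply: ler_pM; rewrite ?powR_ge0//.
  rewrite -powRM//; apply: powRNn_le; rewrite ?mulr_gt0//; last lra.
  by rewrite x2 y2; nra.
rewrite (_ : - (2 * s) = - s + - s); last by lra.
have p2 : 0 < 1 + (x ^+ 2 + y ^+ 2).
  by have := sqr_ge0 x; have := sqr_ge0 y; lra.
rewrite powRD_gt0//; apply: ler_pM; rewrite ?powR_ge0//.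
  by apply: powRNn_le; have := sqr_ge0 x; have := sqr_ge0 y; lra.
by apply: powRNn_le; have := sqr_ge0 x; have := sqr_ge0 y; lra.
Qed.

End PowerInequalities.

(** * Lower bounds for the denominator *)

Section DensityBound.
Variable R : realType.
Implicit Types (s t : R).

Lemma sqr_powR_mul (x s : R) : 0 < x -> x * (x ^+ 2) `^ (s - 1) = x `^ (2 * s - 1).
Proof.
move=> x0; rewrite -powR_mulrn; last exact: ltW.
rewrite -powRrM -[X in X * _](@powRr1 _ x) ?ltW// -powRD_gt0//.
by congr (_ `^ _); ring.
Qed.

(** Here [D] stands for [Den], [al] for the squared norm of the first column, [Dl] for |det|^2, N
    for |z|^2 and M for |z - z0|^2. Interpolating between the two terms of [al * D] produces the
    homogeneous factor al^(2s-1) Dl^(-s), and [mixed_le_shell] absorbs the rest. *)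
Lemma density_le_near_zero s (al Dl N M D : R) : 0 < s <= 1 / 2 ->
  0 < al -> 0 < Dl -> 0 < N -> 0 < M -> al * D = al ^+ 2 * M + Dl ->
  2 / ((1 + N) * D) <=
    16 * (al `^ (2 * s - 1) * Dl `^ (- s)) * (shell s N + shell s M).
Proof.
move=> hs al0 Dl0 N0 M0 eD; have /andP[s0 s1] := hs.
have D1 : D^-1 = al * (al ^+ 2 * M + Dl)^-1.
  by rewrite -eD; field; rewrite !gt_eqF//; move: (mulr_gt0 (exprn_gt0 2 al0) M0); nra.
have ie : D^-1 <= al `^ (2 * s - 1) * Dl `^ (- s) * M `^ (s - 1).
  rewrite D1 -sqr_powR_mul//.
  rewrite (_ : al * _ `^ _ * _ * _ = al * ((al ^+ 2 * M) `^ (s - 1) * Dl `^ (- s))); last first.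
    by rewrite powRM ?sqr_ge0 ?(ltW M0)//; ring.
  rewrite ler_wpM2l ?(ltW al0)//; apply: powR_interpol; rewrite ?mulr_gt0 ?exprn_gt0//; lra.
set K := al `^ _ * _ in ie *.
have K0 : 0 <= K by rewrite mulr_ge0 ?powR_ge0.
have h1 := mixed_le_shell hs M0 N0.
have h2 : (1 + N)^-1 * M `^ (s - 1) <= (1 + N) `^ (- (2 * s)) * M `^ (s - 1).
  by rewrite ler_wpM2r ?powR_ge0// inv_le_powR//; lra.
have i0 : 0 <= (1 + N)^-1 by rewrite invr_ge0; lra.
have {}ie := ler_wpM2l i0 ie.
have h3 := ler_wpM2l K0 (le_trans h2 h1).
have := mulr_ge0 K0 (shell_ge0 s N); have := mulr_ge0 K0 (shell_ge0 s M).
by rewrite invfM; nra.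
Qed.

(** The counterpart for the second column, of squared norm [be]. The coefficient [k] may be
    arbitrarily small, so it is controlled by the last hypothesis: with z0 the zero of the square,
    |z0|^2 = be^2/k, and |z0|^2 <= 2 (|z|^2 + |z - z0|^2). *)
Lemma density_le_near_infty s (be k Dl N M D : R) : 0 < s <= 1 / 2 ->
  0 < be -> 0 < k -> 0 < Dl -> 0 < N -> 0 < M ->
  be * D = k * M + Dl * N -> be ^+ 2 <= 2 * k * (N + M) ->
  2 / ((1 + N) * D) <=
    16 * (be `^ (2 * s - 1) * Dl `^ (- s)) * (shell s N + shell s M).
Proof.
move=> hs be0 k0 Dl0 N0 M0 eD bek; have /andP[s0 s1] := hs.
have kM : 0 < k * M by rewrite mulr_gt0.
have DN : 0 < Dl * N by rewrite mulr_gt0.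
have D1 : D^-1 = be * (k * M + Dl * N)^-1.
  by rewrite -eD; field; rewrite !gt_eqF//; nra.
have S0 : 0 < 2 * (N + M) by lra.
(* As s - 1 < 0, the lower bound be^2/(2(N + M)) on [k] turns into an upper bound; the power of the
   sum is then split by comparing N with M. *)
have kle : k `^ (s - 1) <= (be ^+ 2) `^ (s - 1) * (4 * (N `^ (1 - s) + M `^ (1 - s))).
  have h : k `^ (s - 1) <= (be ^+ 2 * (2 * (N + M))^-1) `^ (s - 1).
    apply: powRNn_le; rewrite ?mulr_gt0 ?exprn_gt0 ?invr_gt0//; last lra.
    by rewrite ler_pdivrMr//; lra.
  apply: le_trans h _; rewrite powRM ?sqr_ge0 ?invr_ge0 ?(ltW S0)//.
  rewrite ler_wpM2l ?powR_ge0//.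
  rewrite -powR_inv1 ?(ltW S0)// -powRrM (_ : -1 * (s - 1) = 1 - s); last by ring.
  have q4 : 4 `^ (1 - s) <= 4 :> R.
    by rewrite -[leRHS]powRr1//; apply: ler_powR; lra.
  have P (A B : R) : 0 < A -> 0 < B -> A <= B ->
      (2 * (A + B)) `^ (1 - s) <= 4 * B `^ (1 - s).
    move=> A0 B0 AB; apply: (@le_trans _ _ ((4 * B) `^ (1 - s))).
      by apply: ge0_ler_powR; rewrite ?nnegrE; lra.
    by rewrite powRM ?(ltW B0)// ler_wpM2r ?powR_ge0.
  have := powR_ge0 N (1 - s); have := powR_ge0 M (1 - s).
  have [NM|/ltW MN] := leP N M; first by have := P _ _ N0 M0 NM; lra.
  by have := P _ _ M0 N0 MN; rewrite (addrC M); lra.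
have ie : D^-1 <= be `^ (2 * s - 1) * Dl `^ (- s) *
    (4 * (N `^ (1 - 2 * s) * M `^ (s - 1) + N `^ (- s))).
  rewrite D1; apply: (@le_trans _ _ (be * ((k * M) `^ (s - 1) * (Dl * N) `^ (- s)))).
    by rewrite ler_wpM2l ?(ltW be0)//; apply: powR_interpol => //; lra.
  rewrite -sqr_powR_mul// (powRM _ (ltW k0) (ltW M0)) (powRM _ (ltW Dl0) (ltW N0)).
  rewrite -!mulrA ler_wpM2l ?(ltW be0)//.
  rewrite (_ : k `^ _ * _ = k `^ (s - 1) * (M `^ (s - 1) * Dl `^ (- s) * N `^ (- s))); last by ring.
  have c0 : 0 <= M `^ (s - 1) * Dl `^ (- s) * N `^ (- s) by rewrite !mulr_ge0 ?powR_ge0.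
  apply: le_trans (ler_wpM2r c0 kle) _.
  rewrite (_ : 1 - 2 * s = (1 - s) + - s); last by ring.
  rewrite (powRD_gt0 (1 - s) (- s) N0).
  have MM : M `^ (1 - s) * M `^ (s - 1) = 1.
    by rewrite -powRD_gt0// (_ : 1 - s + (s - 1) = 0) ?powRr0//; ring.
  rewrite le_eqVlt; apply/orP; left; apply/eqP.
  rewrite (_ : _ * (4 * _) * _ = (be ^+ 2) `^ (s - 1) * Dl `^ (- s) * (4 *
     (N `^ (1 - s) * N `^ (- s) * M `^ (s - 1) +
      M `^ (1 - s) * M `^ (s - 1) * N `^ (- s)))); last by ring.
  by rewrite MM; ring.
set K := be `^ _ * _ in ie *.
have K0 : 0 <= K by rewrite mulr_ge0 ?powR_ge0.
have h1 := mixed_le_shell hs M0 N0.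
have N1 : 0 < 1 + N by lra.
have i0 : 0 <= (1 + N)^-1 by rewrite invr_ge0; lra.
have h2 : (1 + N)^-1 * (N `^ (1 - 2 * s) * M `^ (s - 1)) <=
    (1 + N) `^ (- (2 * s)) * M `^ (s - 1).
  rewrite mulrA ler_wpM2r ?powR_ge0//.
  rewrite [X in _ <= _ `^ X](_ : _ = -1 + (1 - 2 * s)); last by ring.
  rewrite (powRD_gt0 _ _ N1) powR_inv1 ?(ltW N1)// ler_wpM2l//.
  by apply: ge0_ler_powR; rewrite ?nnegrE; lra.
have h4 := powR_div_le_shell hs N0.
have {}ie := ler_wpM2l i0 ie.
have h3 : (1 + N)^-1 * (N `^ (1 - 2 * s) * M `^ (s - 1) + N `^ (- s)) <=
  2 * shell s M + 2 * shell s N.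
  by move: h4; rewrite mulrDr [_ / _]mulrC; lra.
have {}h3 := ler_wpM2l K0 h3.
by rewrite invfM; move: ie h3; set a := (1 + N)^-1; set b := N `^ _ * _ + _; nra.
Qed.

Definition detsq (q : quad R) : R :=
  cnorm2 (csub (cmul (qa q) (qd q)) (cmul (qb q) (qc q))).

Definition normsq (q : quad R) : R :=
  cnorm2 (qa q) + cnorm2 (qb q) + cnorm2 (qc q) + cnorm2 (qd q).

Lemma cnorm2_ge0 (x : cplx R) : 0 <= cnorm2 x.
Proof. by rewrite addr_ge0 ?sqr_ge0. Qed.

Lemma cnorm2_eq0 (x : cplx R) : (cnorm2 x == 0) = (x == (0, 0)).
Proof.
rewrite paddr_eq0 ?sqr_ge0// !expf_eq0/=.
by case: x => x1 x2 /=; rewrite -pair_eqE.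
Qed.

Lemma cnorm2_gt0 (x : cplx R) : (0 < cnorm2 x) = (x != (0, 0)).
Proof. by rewrite lt_neqAle cnorm2_ge0 andbT eq_sym cnorm2_eq0. Qed.

Lemma cnorm2_csub_gt0 (x y : cplx R) : x != y -> 0 < cnorm2 (csub x y).
Proof.
rewrite cnorm2_gt0; apply: contra => /eqP[h1 h2]; apply/eqP.
by rewrite [x]surjective_pairing [y]surjective_pairing; congr (_, _); lra.
Qed.

Lemma detsq_gt0 (q : quad R) : nondeg q -> 0 < detsq q.
Proof. by move=> /eqP h; rewrite cnorm2_gt0. Qed.

(** The larger of the two columns is used to complete the square, and [z0] is the zero of that
    square. The Hermitian product [k] of the columns satisfies Lagrange's identity [abk], which also
    shows that neither column vanishes. *)
Lemma density_le s (q : quad R) : 0 < s <= 1 / 2 -> nondeg q ->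
  exists z0 : cplx R, forall z : cplx R, z != (0, 0) -> z != z0 ->
    2 / ((1 + cnorm2 z) * Den q z) <=
      32 * (normsq q `^ (2 * s - 1) * detsq q `^ (- s)) *
      (shell s (cnorm2 z) + shell s (cnorm2 (csub z z0))).
Proof.
move=> hs /detsq_gt0 D0; have /andP[s0 s1] := hs.
pose al := cnorm2 (qa q) + cnorm2 (qc q).
pose be := cnorm2 (qb q) + cnorm2 (qd q).
pose k : cplx R := (cdot (qa q) (qb q) + cdot (qc q) (qd q),
  ((qa q).1 * (qb q).2 - (qa q).2 * (qb q).1) +
  ((qc q).1 * (qd q).2 - (qc q).2 * (qd q).1)).
have al0 : 0 <= al by rewrite addr_ge0 ?cnorm2_ge0.
have be0 : 0 <= be by rewrite addr_ge0 ?cnorm2_ge0.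
have abk : al * be = cnorm2 k + detsq q.
  rewrite /al /be /k /detsq /cnorm2 /cdot /csub /cmul /=; ring.
have al1 : 0 < al.
  by rewrite lt_neqAle al0 andbT; apply/eqP => e; move: abk (cnorm2_ge0 k); rewrite -e; lra.
have be1 : 0 < be.
  by rewrite lt_neqAle be0 andbT; apply/eqP => e; move: abk (cnorm2_ge0 k); rewrite -e; lra.
have nq : normsq q = al + be by rewrite /normsq /al /be; ring.
(* The dominant column has t >= |q|^2/2; replacing t by |q|^2 costs 2^(1-2s) <= 2, whence 32 in
   place of 16. *)
have finish t (X Y : R) : 0 < t -> normsq q <= 2 * t -> 0 <= Y ->
    X <= 16 * (t `^ (2 * s - 1) * detsq q `^ (- s)) * Y ->
    X <= 32 * (normsq q `^ (2 * s - 1) * detsq q `^ (- s)) * Y.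
  move=> t0 tq Y0 /le_trans; apply; rewrite ler_wpM2r//.
  rewrite (_ : 32 = 16 * 2 :> R); last by lra.
  rewrite -mulrA ler_wpM2l// mulrA ler_wpM2r ?powR_ge0//.
  apply: (@le_trans _ _ ((2^-1 * normsq q) `^ (2 * s - 1))).
    by apply: powRNn_le; rewrite nq in tq *; lra.
  rewrite powRM//; last by rewrite nq; lra.
  rewrite ler_wpM2r ?powR_ge0// -powR_inv1// -powRrM -[leRHS](@powRr1 _ 2)//.
  by apply: ler_powR; lra.
have [ab|ba] := leP be al.
  exists (- (k.1 / al), - (k.2 / al)) => z z1 z2.
  apply: (finish al) => //; first by rewrite nq; lra.
    by rewrite addr_ge0 ?shell_ge0.
  apply: density_le_near_zero => //; first by rewrite cnorm2_gt0.
    exact: cnorm2_csub_gt0.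
  rewrite (_ : al ^+ 2 * _ = cnorm2 (al * z.1 + k.1, al * z.2 + k.2)).
    by rewrite /Den /detsq /al /k /cnorm2 /cdot /csub /cmul /Defs.cadd /=; ring.
  by rewrite /cnorm2 /=; field; rewrite gt_eqF.
have den z : be * Den q z =
    cnorm2 (be + k.1 * z.1 + k.2 * z.2, k.1 * z.2 - k.2 * z.1) + detsq q * cnorm2 z.
  by rewrite /Den /detsq /be /k /cnorm2 /cdot /csub /cmul /Defs.cadd /=; ring.
(* For orthogonal columns the zero -be/conj(k) escapes to infinity. The origin then serves as [z0],
   with the coefficient be^2/|z|^2 chosen so that its product with M = |z|^2 is be^2. *)
have [k0|k0] := eqVneq k (0, 0).
  exists (0, 0) => z z1 _; apply: (finish be) => //; first by rewrite nq; lra.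
    by rewrite addr_ge0 ?shell_ge0.
  have -> : csub z (0, 0) = z by rewrite /csub !subr0 -surjective_pairing.
  have z0 : 0 < cnorm2 z by rewrite cnorm2_gt0.
  apply: (@density_le_near_infty _ _ (be ^+ 2 / cnorm2 z)) => //.
  - by rewrite divr_gt0// exprn_gt0.
  - by rewrite den k0 /= !mul0r /cnorm2 /=; field; rewrite /cnorm2 in z0; rewrite gt_eqF.
  - rewrite (_ : 2 * _ * _ = 4 * be ^+ 2); last by field; rewrite gt_eqF.
    by have := sqr_ge0 be; lra.
have kk : 0 < cnorm2 k by rewrite cnorm2_gt0.
exists (- (be * k.1 / cnorm2 k), - (be * k.2 / cnorm2 k)) => z z1 z2.
apply: (finish be) => //; first by rewrite nq; lra.
  by rewrite addr_ge0 ?shell_ge0.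
apply: (@density_le_near_infty _ _ (cnorm2 k)) => //.
- by rewrite cnorm2_gt0.
- exact: cnorm2_csub_gt0.
- rewrite den; congr (_ + _).
  by rewrite /cnorm2 /= in kk *; field; rewrite gt_eqF.
- set w := csub _ _.
  have -> : be ^+ 2 = cnorm2 k * cnorm2 (csub z w).
    by rewrite /w /cnorm2 /= in kk *; field; rewrite gt_eqF.
  rewrite [2 * _]mulrC -mulrA ler_wpM2l ?cnorm2_ge0// /cnorm2 /=.
  have := sqr_ge0 (z.1 + w.1); have := sqr_ge0 (z.2 + w.2).
  by rewrite /=; nra.
Qed.

End DensityBound.

(** * Integrals over the plane *)

Section PlaneIntegral.
Variable R : realType.
Implicit Types (s : R) (z w : cplx R).

Definition kern2 s z : R := kern s z.1 * kern s z.2.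

Lemma kern2_ge0 s z : 0 < s -> 0 <= kern2 s z.
Proof. by move=> s0; rewrite mulr_ge0 ?kern_ge0. Qed.

Lemma measurable_kern2 s z0 : measurable_fun [set: cplx R] (fun z => kern2 s (csub z z0)).
Proof.
apply: measurable_funM; apply: (measurableT_comp (measurable_kern s));
  by apply: measurable_funB.
Qed.

Lemma kern2_integral s z0 : 0 < s ->
  (\int[@leb2 R]_z (kern2 s (csub z z0))%:E <= 4%:E)%E.
Proof.
move=> s0.
rewrite /leb2 fubini_tonelli1; last 2 first.
- by apply/measurable_EFinP; exact: measurable_kern2.
- by move=> z; rewrite lee_fin kern2_ge0.
rewrite /fubini_F /=.
have mk c : measurable_fun [set: R] (fun x : R => (kern s (x - c))%:E).
  apply/measurable_EFinP; apply: (measurableT_comp (measurable_kern s)).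
  exact: measurable_funB.
have inner x : (\int[@lebesgue_measure R]_y (kern2 s (csub (x, y) z0))%:E =
    (kern s (x - z0.1))%:E * \int[@lebesgue_measure R]_y (kern s (y - z0.2))%:E)%E.
  rewrite -ge0_integralZl_EFin ?kern_ge0//; last exact: mk.
  by move=> y _; rewrite lee_fin kern_ge0.
under eq_integral => x _ do rewrite inner.
apply: (@le_trans _ _ (\int[@lebesgue_measure R]_x (2%:E * (kern s (x - z0.1))%:E))%E).
  apply: ge0_le_integral => //=.
  - by move=> x _; rewrite mule_ge0 ?lee_fin ?kern_ge0// integral_ge0// => y _; rewrite lee_fin kern_ge0.
  - by apply: emeasurable_funM; [exact: mk|exact: measurable_cst].
  - by apply: emeasurable_funM; [exact: measurable_cst|exact: mk].
  - by move=> x _; rewrite muleC lee_pmul ?lee_fin ?kern_ge0// ?kern_integral//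
      integral_ge0// => y _; rewrite lee_fin kern_ge0.
rewrite ge0_integralZl_EFin//; last 2 first.
- by move=> x _; rewrite lee_fin kern_ge0.
- exact: mk.
rewrite (_ : 4%:E = (2%:E * 2%:E)%E); last by rewrite -EFinM; congr EFin; ring.
by rewrite lee_pmul2l// kern_integral.
Qed.

Lemma leb2_line1 (x0 : R) : @leb2 R ([set x0] `*` setT) = 0%E.
Proof. rewrite /leb2 product_measure1E// [X in (X * _)%E](_ : _ = 0%E) ?mul0e//.
exact: lebesgue_measure_set1. Qed.

Lemma leb2_line2 (y0 : R) : @leb2 R (setT `*` [set y0]) = 0%E.
Proof. rewrite /leb2 product_measure1E// [X in (_ * X)%E](_ : _ = 0%E) ?mule0//.
exact: lebesgue_measure_set1. Qed.

(** The constant is 8 = 4 + 4, one mass 4 for each translate of [kern2]. *)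
Lemma plane_integral_le s z0 (C : R) (f : cplx R -> R) : 0 < s -> 0 <= C ->
  measurable_fun setT f -> (forall z, 0 <= f z) ->
  (forall z, z.1 != 0 -> z.2 != 0 -> z.1 != z0.1 -> z.2 != z0.2 ->
     f z <= C * (kern2 s z + kern2 s (csub z z0))) ->
  (\int[@leb2 R]_z (f z)%:E <= (8 * C)%:E)%E.
Proof.
move=> s0 C0 mf f0 fC.
have mk w : measurable_fun [set: cplx R] (fun z => (kern2 s (csub z w))%:E).
  by apply/measurable_EFinP; exact: measurable_kern2.
have k0 w z : (0 <= (kern2 s (csub z w))%:E)%E by rewrite lee_fin kern2_ge0.
apply: (@le_trans _ _ (\int[@leb2 R]_z (C%:E * ((kern2 s (csub z (0, 0)))%:E + (kern2 s (csub z z0))%:E)))%E).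
  apply: ae_ge0_le_integral => //.
  - by move=> z _; rewrite lee_fin.
  - exact/measurable_EFinP.
  - by move=> z _; apply: mule_ge0; [rewrite lee_fin|exact: adde_ge0].
  - apply: emeasurable_funM; first exact: measurable_cst.
    by apply: emeasurable_funD; exact: mk.
  (* These four null lines carry the singularities. For s different from 1 the power convention
     makes the corresponding kernel vanish there, so no pointwise bound can be expected on them. *)
  pose N : set (cplx R) := ([set 0] `*` setT `|` setT `*` [set 0]) `|`
     ([set z0.1] `*` setT `|` setT `*` [set z0.2]).
  have mN1 (x : measurableTypeR R) : measurable ([set x] `*` [set: measurableTypeR R]).
    exact: measurableX.
  have mN2 (x : measurableTypeR R) : measurable ([set: measurableTypeR R] `*` [set x]).
    exact: measurableX.
  exists N; split.
  - by apply: measurableU; apply: measurableU.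
  - apply: null_set_setU; [exact: measurableU|exact: measurableU| |];
      by apply: null_set_setU => //; [exact: leb2_line1|exact: leb2_line2].
  - move=> z /= h; apply: contrapT => nN; apply: h => _.
    rewrite -EFinD -EFinM lee_fin.
    have -> : csub z (0, 0) = z by rewrite /csub !subr0 -surjective_pairing.
    apply: fC; apply/eqP => e; apply: nN.
    + by left; left.
    + by left; right.
    + by right; left.
    + by right; right.
rewrite ge0_integralZl_EFin//; last 2 first.
- by move=> z _; rewrite adde_ge0.
- by apply: emeasurable_funD; exact: mk.
rewrite ge0_integralD//; last 2 first.
- exact: mk.
- exact: mk.
rewrite (_ : (8 * C)%:E = (C%:E * (4%:E + 4%:E))%E); last first.
  by rewrite -EFinD -EFinM; congr EFin; ring.
by rewrite lee_wpmul2l ?lee_fin// leeD// kern2_integral.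
Qed.

Lemma plane_integral_le_shell s z0 (C : R) (f : cplx R -> R) : 0 < s <= 1 / 2 -> 0 <= C ->
  measurable_fun setT f -> (forall z, 0 <= f z) ->
  (forall z, z != (0, 0) -> z != z0 ->
     f z <= C * (shell s (cnorm2 z) + shell s (cnorm2 (csub z z0)))) ->
  (\int[@leb2 R]_z (f z)%:E <= (128 / s ^+ 2 * C)%:E)%E.
Proof.
move=> hs C0 mf f0 fC; have /andP[s0 s1] := hs.
have c0 : 0 <= 16 / s ^+ 2 by rewrite divr_ge0 ?sqr_ge0.
rewrite (_ : 128 / s ^+ 2 * C = 8 * (16 / s ^+ 2 * C)); last by field; rewrite gt_eqF.
apply: (@plane_integral_le s z0) => //; first exact: mulr_ge0.
move=> z x0 y0 x1 y1.
apply: le_trans (fC z _ _) _.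
- by apply: contra x0 => /eqP ->.
- by apply: contra x1 => /eqP ->.
rewrite [_ * C]mulrC -mulrA ler_wpM2l// mulrDr lerD//.
  exact: shell_le_kern.
by apply: shell_le_kern => //; rewrite /= subr_eq0.
Qed.

End PlaneIntegral.

(** * Bounding the metric *)

Section GammaBound.
Variable R : realType.
Implicit Types (s : R) (z w : cplx R) (q u v : quad R).

Definition gamma_integrand q u v z : R :=
  rho z * (cdot (Nv q u z) (Nv q v z) / Den q z ^+ 2).

Lemma Den_ge0 q z : 0 <= Den q z.
Proof. by rewrite addr_ge0 ?cnorm2_ge0. Qed.

Lemma normsq_ge0 q : 0 <= normsq q.
Proof.
rewrite /normsq; have := cnorm2_ge0 (qa q); have := cnorm2_ge0 (qb q).
by have := cnorm2_ge0 (qc q); have := cnorm2_ge0 (qd q); lra.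
Qed.

(** With Z = (z, 1), [Nv q u z] is the 2x2 determinant of the vectors uZ and qZ. Lagrange's identity
    bounds it by |uZ|^2 |qZ|^2, and Cauchy-Schwarz bounds |uZ|^2 by |u|^2 |Z|^2. *)
Lemma Nv_le q u z : cnorm2 (Nv q u z) <= normsq u * (1 + cnorm2 z) * Den q z.
Proof.
have lagrange (x y v w : cplx R) :
    cnorm2 (csub (cmul x w) (cmul y v)) <= (cnorm2 x + cnorm2 v) * (cnorm2 y + cnorm2 w).
  pose t : cplx R := (cdot x y + cdot v w, (x.1 * y.2 - x.2 * y.1) + (v.1 * w.2 - v.2 * w.1)).
  rewrite -subr_ge0 (_ : _ - _ = cnorm2 t) ?cnorm2_ge0//.
  by rewrite /t /cnorm2 /csub /cmul /cdot /=; ring.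
have cs (x y : cplx R) :
    cnorm2 (Defs.cadd (cmul x z) y) <= (cnorm2 x + cnorm2 y) * (1 + cnorm2 z).
  pose t : cplx R := (x.1 - (y.1 * z.1 + y.2 * z.2), x.2 - (y.2 * z.1 - y.1 * z.2)).
  rewrite -subr_ge0 (_ : _ - _ = cnorm2 t) ?cnorm2_ge0//.
  by rewrite /t /cnorm2 /Defs.cadd /cmul /=; ring.
rewrite /Nv; apply: le_trans (lagrange _ _ _ _) _.
apply: ler_wpM2r; first exact: (Den_ge0 q z).
have := cs (qa u) (qb u); have := cs (qc u) (qd u); rewrite /normsq; lra.
Qed.

Lemma cdotxx z : cdot z z = cnorm2 z.
Proof. by rewrite /cdot /cnorm2 !expr2. Qed.

Lemma gamma_integrand_ge0 q u z : 0 <= gamma_integrand q u u z.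
Proof.
rewrite /gamma_integrand /rho cdotxx.
by rewrite mulr_ge0 ?divr_ge0 ?cnorm2_ge0 ?sqr_ge0.
Qed.

Lemma gamma_integrand_le q u z :
  gamma_integrand q u u z <= normsq u * (2 / ((1 + cnorm2 z) * Den q z)).
Proof.
rewrite /gamma_integrand cdotxx /rho.
have N1 : 0 < 1 + cnorm2 z by rewrite ltr_pwDl ?cnorm2_ge0.
(* If [Den q z] is 0, division by zero makes both sides 0. *)
have := Den_ge0 q z; rewrite le_eqVlt => /orP[/eqP <-|D0].
  by rewrite expr0n/= invr0 !mulr0 invr0 !mulr0.
rewrite mulrA ler_pdivrMr ?exprn_gt0// mulrAC ler_pdivrMr ?exprn_gt0//.
rewrite (_ : normsq u * _ * _ * _ = 2 * (normsq u * (1 + cnorm2 z) * Den q z)).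
  by rewrite ler_wpM2l// Nv_le.
by field; rewrite !gt_eqF.
Qed.

Lemma measurable_Nv q u :
  measurable_fun [set: cplx R] (fun z => (Nv q u z).1) /\
  measurable_fun [set: cplx R] (fun z => (Nv q u z).2).
Proof.
split; rewrite /Nv /csub /Defs.cadd /cmul /=;
by repeat first [apply: measurable_funB|apply: measurable_funD|apply: measurable_funM].
Qed.

Lemma measurable_Den q : measurable_fun [set: cplx R] (Den q).
Proof.
rewrite /Den /cnorm2 /Defs.cadd /cmul /=.
by repeat first [apply: measurable_funX|apply: measurable_funB
  |apply: measurable_funD|apply: measurable_funM].
Qed.

Lemma measurable_cnorm2 z0 : measurable_fun [set: cplx R] (fun z => cnorm2 (csub z z0)).
Proof.
rewrite /cnorm2 /csub /=.
by repeat first [apply: measurable_funX|apply: measurable_funB|apply: measurable_funD].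
Qed.

Lemma csub0 z : csub z (0, 0) = z.
Proof. by rewrite /csub !subr0 -surjective_pairing. Qed.

Lemma measurable_rho : measurable_fun [set: cplx R] (@rho R).
Proof.
apply: measurable_funM => //; apply: measurable_inv_ge0 => [z|]; first exact: sqr_ge0.
apply: measurable_funX; apply: measurable_funD => //.
rewrite (_ : @cnorm2 R = (fun z => cnorm2 (csub z (0, 0)))); last first.
  by apply/funext => z; rewrite csub0.
exact: measurable_cnorm2.
Qed.

Lemma measurable_gamma_integrand q u v :
  measurable_fun [set: cplx R] (gamma_integrand q u v).
Proof.
have [u1 u2] := measurable_Nv q u; have [v1 v2] := measurable_Nv q v.
apply: measurable_funM; first exact: measurable_rho.
apply: measurable_funM.
  by apply: measurable_funD; apply: measurable_funM.
apply: measurable_inv_ge0 => [z|]; first exact: sqr_ge0.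
by apply: measurable_funX; exact: measurable_Den.
Qed.

(** Equal to 32 times 128/s^2, the constants of [density_le] and [plane_integral_le_shell]. *)
Definition gamma_cst s : R := (64 / s) ^+ 2.

Lemma gamma_cst_ge0 s : 0 <= gamma_cst s.
Proof. exact: sqr_ge0. Qed.

Lemma gamma_integral_le s q u : 0 < s <= 1 / 2 -> nondeg q ->
  (\int[@leb2 R]_z (gamma_integrand q u u z)%:E <=
   (gamma_cst s * normsq u * (normsq q `^ (2 * s - 1) * detsq q `^ (- s)))%:E)%E.
Proof.
move=> hs nq; have [z0 hz0] := density_le hs nq.
set K := normsq q `^ _ * _ in hz0 *.
have K0 : 0 <= K by rewrite mulr_ge0 ?powR_ge0.
rewrite (_ : gamma_cst s * _ * _ = 128 / s ^+ 2 * (normsq u * (32 * K))); last first.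
  by rewrite /gamma_cst exprMn exprVn (_ : 64 ^+ 2 = 128 * 32 :> R); [ring|lra].
apply: (@plane_integral_le_shell _ s z0) => //.
- by rewrite mulr_ge0 ?normsq_ge0// mulr_ge0.
- exact: measurable_gamma_integrand.
- by move=> z; exact: gamma_integrand_ge0.
- move=> z z1 z2; apply: le_trans (gamma_integrand_le _ _ _) _.
  by rewrite -mulrA ler_wpM2l ?normsq_ge0// hz0.
Qed.

Lemma gammaL2_le s q u : 0 < s <= 1 / 2 -> nondeg q ->
  gammaL2 q u u <= gamma_cst s * normsq u * (normsq q `^ (2 * s - 1) * detsq q `^ (- s)).
Proof.
move=> hs nq; rewrite -lee_fin; apply: le_trans (gamma_integral_le u hs nq).
rewrite /gammaL2 /Rintegral fineK// ge0_fin_numE.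
  by apply: le_lt_trans (gamma_integral_le u hs nq) _; rewrite ltry.
by apply: integral_ge0 => z _; rewrite lee_fin gamma_integrand_ge0.
Qed.

Lemma gammaL2_ge0 q u : 0 <= gammaL2 q u u.
Proof. by apply: Rintegral_ge0 => z _; exact: gamma_integrand_ge0. Qed.

(** The mixed integrand is dominated by the sum of the two diagonal ones, which are integrable by
    the bound at s = 1/2. *)
Lemma integrable_gamma q u v : nondeg q ->
  (@leb2 R).-integrable [set: cplx R] (EFin \o gamma_integrand q u v).
Proof.
move=> nq.
have hs : (0 < (1 / 2 : R)) && ((1 / 2 : R) <= 1 / 2) by lra.
have diag (w : quad R) : (@leb2 R).-integrable [set: cplx R] (EFin \o gamma_integrand q w w).
  apply/integrableP; split.
    by apply/measurable_EFinP; exact: measurable_gamma_integrand.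
  under eq_integral => z _.
    rewrite /= ger0_norm ?gamma_integrand_ge0//.
    over.
  by apply: le_lt_trans (gamma_integral_le w hs nq) _; rewrite ltry.
apply: (le_integrable measurableT _ _ (integrableD measurableT (diag u) (diag v))) => //.
  by apply/measurable_EFinP; exact: measurable_gamma_integrand.
move=> z _; rewrite /= lee_fin [leRHS]ger0_norm ?addr_ge0 ?gamma_integrand_ge0//.
have r0 : 0 <= rho z by rewrite /rho divr_ge0 ?sqr_ge0.
rewrite /gamma_integrand -mulrDr -mulrDl normrM (ger0_norm r0) ler_wpM2l//.
rewrite normrM [`|_^-1|]ger0_norm ?invr_ge0 ?sqr_ge0//.
rewrite ler_wpM2r ?invr_ge0 ?sqr_ge0// ler_norml /cdot.
set a := Nv q u z; set b := Nv q v z.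
have := sqr_ge0 (a.1 - b.1); have := sqr_ge0 (a.2 - b.2).
have := sqr_ge0 (a.1 + b.1); have := sqr_ge0 (a.2 + b.2).
have := sqr_ge0 a.1; have := sqr_ge0 a.2; have := sqr_ge0 b.1; have := sqr_ge0 b.2.
by rewrite !expr2 => *; apply/andP; split; nra.
Qed.

End GammaBound.

(** * Hadamard's inequality *)

Section Hadamard.
Variable R : realFieldType.

Definition psdmx n (A : 'M[R]_n) : Prop :=
  A^T = A /\ forall v : 'rV[R]_n, 0 <= (v *m A *m v^T) 0 0.

Lemma psdmx_congr m n (P : 'M[R]_(m, n)) (A : 'M[R]_n) :
  psdmx A -> psdmx (P *m A *m P^T).
Proof.
move=> [sA pA]; split; first by rewrite !trmx_mul trmxK sA mulmxA.
by move=> v; have := pA (v *m P); rewrite trmx_mul !mulmxA.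
Qed.

Lemma psdmx_delta n (A : 'M[R]_n) i j :
  ((delta_mx 0 i : 'rV[R]_n) *m A *m (delta_mx 0 j : 'rV[R]_n)^T) 0 0 = A i j.
Proof. by rewrite -rowE trmx_delta -colE !mxE. Qed.

Lemma psdmx_diag n (A : 'M[R]_n) i : psdmx A -> 0 <= A i i.
Proof. by move=> [_ pA]; rewrite -psdmx_delta. Qed.

Lemma psdmx_quad2 n (A : 'M[R]_n) i j t : psdmx A ->
  0 <= A i i + 2 * t * A i j + t ^+ 2 * A j j.
Proof.
move=> [sA pA]; have := pA (delta_mx 0 i + t *: delta_mx 0 j).
have addE (B C : 'M[R]_1) : (B + C) 0 0 = B 0 0 + C 0 0 by rewrite mxE.
have scaleE c (B : 'M[R]_1) : (c *: B) 0 0 = c * B 0 0 by rewrite mxE.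
rewrite linearD linearZ /= !mulmxDl !mulmxDr.
do ?[rewrite -scalemxAl|rewrite -scalemxAr].
rewrite !(addE, scaleE) !psdmx_delta.
have -> : A j i = A i j by rewrite -[in LHS]sA mxE.
by rewrite (_ : _ + _ = A i i + 2 * t * A i j + t ^+ 2 * A j j)//; ring.
Qed.

Lemma psdmx_diag0 n (A : 'M[R]_n) i j : psdmx A -> A i i = 0 -> A i j = 0.
Proof.
move=> pA Aii; apply/eqP; apply: contraT => Aij.
have sq t : 0 <= 2 * t * A i j + t ^+ 2 * A j j.
  by have := psdmx_quad2 i j t pA; rewrite Aii add0r.
have Ajj := psdmx_diag j pA.
(* Near the minimum of the quadratic; the added 1 keeps the denominator positive even when [A j j]
   is 0. *)
pose t := - (A i j / (A j j + 1)).
have J1 : 0 < A j j + 1 by lra.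
have := sq t; rewrite leNgt => /negP[].
have -> : 2 * t * A i j + t ^+ 2 * A j j = - (A i j / (A j j + 1)) ^+ 2 * (A j j + 2).
  by rewrite /t; field; rewrite gt_eqF.
rewrite mulNr oppr_lt0 mulr_gt0//; last by lra.
by rewrite exprn_even_gt0//= mulf_neq0// invr_eq0 gt_eqF.
Qed.

(* Induction through the Schur complement of the first diagonal entry. *)
Lemma psdmx_det_le n (A : 'M[R]_n) : psdmx A -> \det A <= \prod_i A i i.
Proof.
elim: n A => [A _|n IH A pA]; first by rewrite det_mx00 big_ord0.
have prod0 : 0 <= \prod_i A i i by apply: prodr_ge0 => i _; exact: psdmx_diag.
(* A zero diagonal entry forces its whole row to vanish, so the determinant is 0. *)
have [a0|a0] := eqVneq (A 0 0) 0.
  rewrite (_ : \det A = 0)//; rewrite (expand_det_row A 0).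
  by apply: big1 => j _; rewrite (psdmx_diag0 j pA a0) mul0r.
have ap : 0 < A 0 0 by rewrite lt_neqAle eq_sym a0 psdmx_diag.
(* The unipotent matrix of Gaussian elimination that clears the first column below the pivot
   [A 0 0]. *)
pose P : 'M[R]_(n.+1) := \matrix_(i, j)
  (if i == 0 then (j == 0)%:R else (i == j)%:R - (j == 0)%:R * (A i 0 / A 0 0)).
have dP : \det P = 1.
  rewrite det_trig.
    apply: big1 => i _; rewrite mxE; case: (eqVneq i 0) => [_|i0] //.
    by rewrite eqxx mul0r subr0.
  apply/forallP => i; apply/forallP => j; apply/implyP => ij; rewrite mxE.
  have ji : j != 0 by rewrite -val_eqE /= -lt0n; apply: leq_ltn_trans ij.
  have ij' : i != j by rewrite -val_eqE neq_ltn ij.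
  by rewrite (negbTE ji) (negbTE ij') mul0r subr0 if_same.
pose B := P *m A *m P^T.
have pB : psdmx B by exact: psdmx_congr.
have dB : \det B = \det A by rewrite !det_mulmx det_tr dP mul1r mulr1.
have PA i j : (P *m A) i j = if i == 0 then A 0 j else A i j - A i 0 / A 0 0 * A 0 j.
  rewrite !mxE; case: (eqVneq i 0) => [->|i0].
    rewrite (bigD1 0)//= big1 ?addr0 ?mxE ?eqxx ?mul1r// => k k0.
    by rewrite mxE eqxx (negbTE k0) mul0r.
  rewrite (bigD1 0)//= (bigD1 i)//= big1 ?addr0; last first.
    move=> k /andP[k0 ki]; rewrite mxE (negbTE i0) (negbTE k0) eq_sym (negbTE ki).
    by rewrite mul0r subr0 mul0r.
  rewrite !mxE (negbTE i0) !eqxx /= mul0r subr0 !mul1r.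
  by rewrite sub0r mulNr addrC.
have sA i j : A i j = A j i by case: pA => sA _; rewrite -[in LHS]sA mxE.
have BE i j : i != 0 -> B i j = if j == 0 then 0 else A i j - A i 0 / A 0 0 * A 0 j.
  move=> i0; rewrite /B -[P *m A]trmxK -trmx_mul mxE mxE.
  under eq_bigr => k _ do rewrite [(P *m A)^T _ _]mxE PA (negbTE i0).
  case: (eqVneq j 0) => [->|j0].
    rewrite (bigD1 0)//= big1 ?addr0 ?mxE ?eqxx ?mul1r => [|k k0].
      by field.
    by rewrite mxE eqxx (negbTE k0) mul0r.
  rewrite (bigD1 0)//= (bigD1 j)//= big1 ?addr0; last first.
    move=> k /andP[k0 kj]; rewrite mxE (negbTE j0) (negbTE k0) eq_sym (negbTE kj).
    by rewrite mul0r subr0 mul0r.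
  rewrite !mxE (negbTE j0) !eqxx /= mul0r subr0 !mul1r.
  by field.
have B00 : B 0 0 = A 0 0.
  rewrite /B mxE (bigD1 0)//= big1 ?addr0 => [|k k0].
    by rewrite PA eqxx !mxE !eqxx mulr1.
  by rewrite !mxE eqxx (negbTE k0) mulr0.
have dBE : \det B = A 0 0 * \det (row' 0 (col' 0 B)).
  rewrite (expand_det_col B 0) (bigD1 0)//= big1 ?addr0.
    by rewrite /cofactor /= expr0 mul1r B00.
  by move=> i i0; rewrite BE// eqxx mul0r.
have pB' : psdmx (row' 0 (col' 0 B)).
  have -> : row' 0 (col' 0 B) = row' 0 1%:M *m B *m (row' 0 1%:M)^T.
    rewrite tr_row' trmx1 !row'Esub !col'Esub mul_rowsub_mx mul1mx mulmx_colsub mulmx1.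
    by apply/matrixP => i j; rewrite !mxE.
  exact: psdmx_congr.
rewrite -dB dBE big_ord_recl ler_wpM2l ?(ltW ap)//.
apply: le_trans (IH _ pB') _; apply: ler_prod => i _.
rewrite psdmx_diag//=.
rewrite (_ : row' 0 (col' 0 B) i i = B (lift ord0 i) (lift ord0 i)); last by rewrite mxE mxE.
rewrite BE//=.
(* The Schur complement has diagonal A_ii - A_i0^2/A_00, which is at most A_ii. *)
rewrite lerBlDr lerDl (sA 0) mulrAC divr_ge0 ?(ltW ap)//.
by rewrite -expr2 sqr_ge0.
Qed.

(** Hadamard's inequality for the Gram matrix in the basis where the k-th vector is replaced by [v];
    this change of basis has determinant [v 0 k]. *)
Lemma psdmx_det_le_dir n (G : 'M[R]_n) (v : 'rV[R]_n) (k : 'I_n) : psdmx G ->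
  \det G * v 0 k ^+ 2 <= (v *m G *m v^T) 0 0 * \prod_(i | i != k) G i i.
Proof.
move=> pG.
pose P : 'M[R]_n := \matrix_(i, j) (if i == k then v 0 j else (i == j)%:R).
have rP i : row i P = if i == k then v else delta_mx 0 i.
  by apply/rowP => j; rewrite !mxE; case: ifP => // _; rewrite !mxE eqxx/= eq_sym.
have dP : \det P = v 0 k.
  rewrite (expand_det_row P k).
  (* Cofactors along row k do not see that row, the only one in which P differs from the
     identity. *)
  have cof j : cofactor P k j = cofactor (1%:M : 'M[R]_n) k j.
    congr (_ * \det _); apply/matrixP => a b; rewrite !mxE.
    by rewrite (negbTE (_ : lift k a != k)) // eq_sym neq_lift.
  transitivity ((v *m \adj (1%:M : 'M[R]_n)) 0 k).
    rewrite mxE; apply: eq_bigr => j _; rewrite cof !mxE eqxx//.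
  by rewrite -[\adj _]mul1mx mul_mx_adj det1 mulmx1.
have -> : \det G * v 0 k ^+ 2 = \det (P *m G *m P^T).
  by rewrite !det_mulmx det_tr dP; ring.
apply: le_trans (psdmx_det_le (psdmx_congr P pG)) _.
have E i : (P *m G *m P^T) i i = (row i P *m G *m (row i P)^T) 0 0.
  by rewrite tr_row -row_mul -[RHS]/((row i (P *m G) *m col i P^T) 0 0) !mxE;
    apply: eq_bigr => j _; rewrite !mxE.
rewrite (bigD1 k)//= E rP eqxx le_eqVlt; apply/orP; left; apply/eqP; congr (_ * _).
by apply: eq_bigr => i ik; rewrite E rP (negbTE ik) psdmx_delta.
Qed.

End Hadamard.

(** * Iterated Tonelli *)

Section SigmaFiniteProduct.
Local Open Scope ereal_scope.
Context d1 d2 (T1 : measurableType d1) (T2 : measurableType d2) (R : realType).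
Variable m1 : {sigma_finite_measure set T1 -> \bar R}.
Variable m2 : {sigma_finite_measure set T2 -> \bar R}.

(* A name for [m1 \x m2] that can carry the canonical sigma-finite structure
   needed to iterate Tonelli's theorem. *)
Definition prod_sfm : set (T1 * T2) -> \bar R := m1 \x m2.

HB.instance Definition _ := Measure.copy prod_sfm (m1 \x m2).

Lemma sigma_finite_prod_sfm : sigma_finite setT prod_sfm.
Proof.
have /sigma_finiteP[F [TF ndF Foo]] := sigma_finiteT m1.
have /sigma_finiteP[G [TG ndG Goo]] := sigma_finiteT m2.
exists (fun n => F n `*` G n).
  rewrite -setXTT TF TG predeqE => -[x y]; split => /= [[[i _ Fix] [j _ Gjy]]|].
    exists (maxn i j) => //; split.
      by move: x Fix; apply/subsetPset/ndF/leq_maxl.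
    by move: y Gjy; apply/subsetPset/ndG/leq_maxr.
  by move=> [i _ [Fix Giy]]; split; exists i.
move=> i; have [mF Fi] := Foo i; have [mG Gi] := Goo i.
split; first exact: measurableX.
by rewrite /prod_sfm product_measure1E// lte_mul_pinfty// ge0_fin_numE.
Qed.

HB.instance Definition _ :=
  Measure_isSigmaFinite.Build _ _ _ prod_sfm sigma_finite_prod_sfm.

End SigmaFiniteProduct.

Section IntegralTools.
Local Open Scope ereal_scope.

(* Unlike [ge0_le_integral], no measurability is required. *)
Lemma integral_ge0_mono d (T : measurableType d) (R : realType)
    (mu : {measure set T -> \bar R}) (D : set T) (f g : T -> \bar R) :
  (forall x, D x -> 0 <= f x) -> (forall x, D x -> f x <= g x) ->
  \int[mu]_(x in D) f x <= \int[mu]_(x in D) g x.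
Proof.
move=> f0 fg.
have g0 x : D x -> 0 <= g x by move=> Dx; apply: le_trans (fg x Dx); exact: f0.
rewrite !ge0_integralE//; apply: le_ereal_sup => _ [h hf <-].
exists h => //= x; apply: le_trans (hf x) _.
by rewrite /patch; case: ifPn => // /set_mem; exact: fg.
Qed.

Lemma tonelli_le d1 d2 (T1 : measurableType d1) (T2 : measurableType d2)
    (R : realType) (m1 : {sigma_finite_measure set T1 -> \bar R})
    (m2 : {sigma_finite_measure set T2 -> \bar R})
    (f : T1 * T2 -> \bar R) (g : T2 -> \bar R) :
  measurable_fun setT f -> (forall x, 0 <= f x) ->
  (forall y, \int[m1]_x f (x, y) <= g y) ->
  \int[m1 \x m2]_z f z <= \int[m2]_y g y.
Proof.
move=> mf f0 fg; rewrite fubini_tonelli2//; apply: integral_ge0_mono => y _.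
  by apply: integral_ge0 => x _; exact: f0.
exact: fg.
Qed.

(** Passing first to the measurable majorant [g] lets Tonelli be applied twice. The variable [a] is
    integrated first: in the volume bound the singularity sits at a = bc, for fixed [b] and [c]. *)
Lemma triple_integral_le d (T : measurableType d) (R : realType)
    (m : {sigma_finite_measure set T -> \bar R})
    (f g : T * T * T -> \bar R) (G : T -> T -> \bar R) (H : T -> \bar R) :
  (forall x, 0 <= f x) -> (forall x, f x <= g x) -> measurable_fun setT g ->
  (forall b c, \int[m]_a g (a, b, c) <= G c b) ->
  (forall c, \int[m]_b G c b <= H c) ->
  \int[prod_sfm m m \x m]_x f x <= \int[m]_c H c.
Proof.
move=> f0 fg mg gG GH.
have g0 x : 0 <= g x by exact: le_trans (f0 x) (fg x).
apply: (@le_trans _ _ (\int[prod_sfm m m \x m]_x g x)).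
  by apply: integral_ge0_mono => x _.
apply: tonelli_le => [||c]; [by []|by []|].
apply: le_trans (GH c); apply: tonelli_le => [|a|b].
- by apply: (measurableT_comp mg); exact: measurable_fun_pair.
- by [].
- by [].
Qed.

End IntegralTools.

Lemma Rintegral_sum d (T : measurableType d) (R : realType)
    (mu : {measure set T -> \bar R}) (D : set T) (I : Type) (r : seq I)
    (f : I -> T -> R) : measurable D ->
  (forall i, mu.-integrable D (EFin \o f i)) ->
  (\int[mu]_(x in D) (\sum_(i <- r) f i x) = \sum_(i <- r) \int[mu]_(x in D) f i x)%R.
Proof.
move=> mD fi; elim: r => [|i r IH].
  rewrite big_nil (_ : (fun x => _) = cst 0); last by apply/funext => x; rewrite big_nil.
  by rewrite /Rintegral integral0_eq.
have E : (fun x => \sum_(j <- i :: r) f j x) = (fun x => f i x + \sum_(j <- r) f j x).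
  by apply/funext => x; rewrite big_cons.
rewrite big_cons -IH E RintegralD//.
rewrite (_ : EFin \o _ = (fun x => \sum_(j <- r) (EFin \o f j) x)%E).
  exact: integrable_sum.
by apply/funext => x /=; rewrite sumEFin.
Qed.

(** * The volume density *)

Section Volume.
Variable R : realType.
Implicit Types (s : R) (z w : cplx R) (q u v : quad R) (x : cplx R * cplx R * cplx R).

Lemma big_ord6 (F : 'I_6 -> R) : \sum_k F k =
  F (inord 0) + F (inord 1) + F (inord 2) + F (inord 3) + F (inord 4) + F (inord 5).
Proof.
rewrite !big_ord_recl big_ord0 addr0 !addrA.
by repeat (congr (_ + _)); congr F; apply: val_inj; rewrite /= inordK.
Qed.

Definition dirvec (c : 'rV[R]_6) : quad R :=
  ((c 0 (inord 0), c 0 (inord 1)), (c 0 (inord 2), c 0 (inord 3)),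
   (c 0 (inord 4), c 0 (inord 5)), (0, 0)).

Lemma Nv_dirvec q c z :
  Nv q (dirvec c) z = (\sum_k c 0 k * (Nv q (coorddir R k) z).1,
                       \sum_k c 0 k * (Nv q (coorddir R k) z).2).
Proof.
rewrite !big_ord6 /dirvec /coorddir !inordK//=.
by rewrite /Nv /csub /Defs.cadd /cmul /=; congr (_, _); ring.
Qed.

(** Bilinearity holds under the integral sign, and integrability of each entry lets the sums out. It
    exhibits the Gram matrix as positive semidefinite. *)
Lemma gram_quadratic x c : nondeg (chart x) ->
  (c *m gram x *m c^T) 0 0 = gammaL2 (chart x) (dirvec c) (dirvec c).
Proof.
move=> nq; set q := chart x.
transitivity (\sum_i \sum_j c 0 i * c 0 j * gammaL2 q (coorddir R i) (coorddir R j)).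
  rewrite exchange_big/= mxE; apply: eq_bigr => j _.
  by rewrite mxE mulr_suml; apply: eq_bigr => i _; rewrite !mxE mulrAC.
pose F i j z := c 0 i * c 0 j * gamma_integrand q (coorddir R i) (coorddir R j) z.
have iF i j : (@leb2 R).-integrable setT (EFin \o F i j).
  rewrite (_ : EFin \o _ = (fun z => (c 0 i * c 0 j)%:E *
    (gamma_integrand q (coorddir R i) (coorddir R j) z)%:E)%E); last first.
    by apply/funext => z /=; rewrite EFinM.
  by apply: integrableZl => //; exact: integrable_gamma.
have E : (fun z => gamma_integrand q (dirvec c) (dirvec c) z) =
    (fun z => \sum_i \sum_j F i j z).
  apply/funext => z; rewrite /F /gamma_integrand Nv_dirvec /cdot /= !mulr_suml -big_split/=.
  rewrite mulr_suml mulr_sumr; apply: eq_bigr => i _.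
  rewrite !mulr_sumr -big_split/= mulr_suml mulr_sumr; apply: eq_bigr => j _.
  by ring.
rewrite [RHS](_ : _ = (\int[@leb2 R]_z (\sum_i \sum_j F i j z))%R); last first.
  by congr Rintegral; exact: E.
rewrite Rintegral_sum//; last first.
  move=> i; rewrite (_ : EFin \o _ = (fun z => \sum_j (EFin \o F i j) z)%E).
    exact: integrable_sum.
  by apply/funext => z /=; rewrite sumEFin.
apply: eq_bigr => i _; rewrite Rintegral_sum//; apply: eq_bigr => j _.
by rewrite RintegralZl//; exact: integrable_gamma.
Qed.

Lemma gammaL2C q u v : gammaL2 q u v = gammaL2 q v u.
Proof.
rewrite /gammaL2; congr Rintegral; apply/funext => z; rewrite /cdot.
by congr (_ * (_ / _)); ring.
Qed.

Lemma gram_psd x : nondeg (chart x) -> psdmx (gram x).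
Proof.
move=> nq; split; first by apply/matrixP => i j; rewrite !mxE gammaL2C.
by move=> c; rewrite gram_quadratic// gammaL2_ge0.
Qed.

Definition coords x : 'rV[R]_6 :=
  \row_k nth 0 [:: x.1.1.1; x.1.1.2; x.1.2.1; x.1.2.2; x.2.1; x.2.2] k.

(* The radial variation [q] itself is trivial in projective space, so the
   variation [(a, b, c, 0)] acts as [-(0, 0, 0, 1)]. *)
Lemma gammaL2_coords x : gammaL2 (chart x) (dirvec (coords x)) (dirvec (coords x)) =
  gammaL2 (chart x) ((0, 0), (0, 0), (0, 0), (1, 0)) ((0, 0), (0, 0), (0, 0), (1, 0)).
Proof.
rewrite /gammaL2; congr Rintegral; apply/funext => z; congr (_ * (_ / _)).
rewrite /dirvec /coords !mxE !inordK//=.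
by case: x => [[[a1 a2] [b1 b2]] [c1 c2]]; rewrite /cdot /Nv /csub /Defs.cadd /cmul /=; ring.
Qed.

Lemma normsq_chart x :
  normsq (chart x) = 1 + cnorm2 x.1.1 + cnorm2 x.1.2 + cnorm2 x.2.
Proof. by rewrite /normsq /chart /cnorm2 /=; ring. Qed.

(** |q|^2 is 1 plus the sum of the six squared coordinates. Plain Hadamard handles the 1, and
    Hadamard along the radial direction, whose metric norm is that of a unit variation, handles each
    square: seven terms, each at most B^6. *)
Lemma det_gram_le s x : 0 < s <= 1 / 2 -> nondeg (chart x) ->
  \det (gram x) * normsq (chart x) <= 7 *
   (gamma_cst s * (normsq (chart x) `^ (2 * s - 1) * detsq (chart x) `^ (- s))) ^+ 6.
Proof.
move=> hs nq; set B := gamma_cst s * _.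
have pG := gram_psd nq.
have Gle u : normsq u = 1 -> gammaL2 (chart x) u u <= B.
  by move=> u1; apply: le_trans (gammaL2_le u hs nq) _; rewrite u1 mulr1.
have Gii i : 0 <= gram x i i <= B.
  rewrite psdmx_diag//= mxE Gle// /normsq /coorddir /cnorm2.
  by case: i => [] [|[|[|[|[|[|//]]]]]] hi /=; ring.
have B0 : 0 <= B by have /andP[h1 h2] := Gii 0; exact: le_trans h2.
have d1 : \det (gram x) <= B ^+ 6.
  apply: le_trans (psdmx_det_le pG) _.
  rewrite (_ : B ^+ 6 = \prod_(i < 6) B); last by rewrite prodr_const card_ord.
  by apply: ler_prod => i _.
have d2 k : \det (gram x) * coords x 0 k ^+ 2 <= B ^+ 6.
  apply: le_trans (psdmx_det_le_dir (coords x) k pG) _.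
  rewrite gram_quadratic// gammaL2_coords exprS; apply: ler_pM.
  - exact: gammaL2_ge0.
  - by apply: prodr_ge0 => i _; have /andP[] := Gii i.
  - by apply: Gle; rewrite /normsq /cnorm2 /=; ring.
  - rewrite (_ : B ^+ 5 = \prod_(i < 6 | i != k) B); last first.
      have c5 : #|predC1 k| = 5%N by rewrite cardC1 card_ord.
      rewrite prodr_const; congr (B ^+ _); apply/esym; rewrite -[RHS]c5.
      by apply: eq_card => i; rewrite !inE.
    by apply: ler_prod => i _.
rewrite (_ : normsq _ = 1 + \sum_k coords x 0 k ^+ 2).
  rewrite mulrDr mulr1 mulr_sumr (_ : 7 * _ = B ^+ 6 + \sum_(k < 6) B ^+ 6).
    by apply: lerD => //; apply: ler_sum => k _.
  by rewrite sumr_const card_ord -mulr_natl; ring.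
by rewrite normsq_chart big_ord6 /coords !mxE !inordK//= /cnorm2; ring.
Qed.

Lemma voldens_le s : 0 < s <= 1 / 2 -> exists2 C : R, 0 <= C & forall x,
  voldens x <= C * (normsq (chart x) `^ (6 * s - 7 / 2) * detsq (chart x) `^ (- (3 * s))).
Proof.
move=> hs; exists (3 * gamma_cst s ^+ 3).
  by rewrite mulr_ge0// exprn_ge0// gamma_cst_ge0.
have c0 : 0 <= 3 * gamma_cst s ^+ 3 by rewrite mulr_ge0// exprn_ge0// gamma_cst_ge0.
have K0 x r t : 0 <= 3 * gamma_cst s ^+ 3 *
    (normsq (chart x) `^ r * detsq (chart x) `^ t).
  by apply: (mulr_ge0 c0); apply: mulr_ge0; exact: powR_ge0.
move=> x; rewrite /voldens; case: asboolP => [nq|_]; last exact: K0.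
have T0 : 0 < normsq (chart x).
  rewrite normsq_chart; have := cnorm2_ge0 x.1.1; have := cnorm2_ge0 x.1.2.
  by have := cnorm2_ge0 x.2; lra.
have D0 := detsq_gt0 nq.
have := det_gram_le hs nq.
set T := normsq _ in T0 *; set Dl := detsq _ in D0 *; set d := \det _ => dle.
set Y := 3 * _ * _.
have Y0 : 0 <= Y by exact: K0.
rewrite -[leRHS](ger0_norm Y0) -sqrtr_sqr ler_wsqrtr//.
have pw (r : R) (n : nat) (X : R) : 0 < X -> (X `^ r) ^+ n = X `^ (r * n%:R).
  by move=> X0; rewrite -powR_mulrn ?powR_ge0// powRrM.
(* The exponents match since 2 (6s - 7/2) + 1 = 6 (2s - 1); the constant 9 is a perfect square above
   7. *)
have YE : Y ^+ 2 * T = 9 * (gamma_cst s * (T `^ (2 * s - 1) * Dl `^ (- s))) ^+ 6.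
  rewrite /Y; move: (gamma_cst s) => g; rewrite !exprMn !pw// -[in X in _ * X](@powRr1 _ T) ?(ltW T0)//.
  rewrite (_ : (6 * s - 7 / 2) * 2%:R = (2 * s - 1) * 6%:R - 1); last by field.
  rewrite (_ : - (3 * s) * 2%:R = - s * 6%:R); last by ring.
  rewrite (_ : _ * T `^ 1 = 3 ^+ 2 * g ^+ 6 * (T `^ ((2 * s - 1) * 6%:R - 1) * T `^ 1) * Dl `^ (- s * 6%:R)); last by ring.
  by rewrite -powRD_gt0// subrK; ring.
rewrite -(ler_pM2r T0) YE; apply: le_trans dle _.
rewrite ler_wpM2r//; last by lra.
by apply: exprn_ge0; apply: mulr_ge0; rewrite ?gamma_cst_ge0 ?mulr_ge0 ?powR_ge0.
Qed.

End Volume.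

(** * Finite volume *)

Section VolumeIntegral.
Variable R : realType.
Implicit Types (s : R) (z w : cplx R) (x : cplx R * cplx R * cplx R).

Definition bracket s z : R := (1 + cnorm2 z) `^ (- (1 + s)).

Lemma bracket_ge0 s z : 0 <= bracket s z.
Proof. exact: powR_ge0. Qed.

Lemma measurable_bracket s : measurable_fun [set: cplx R] (bracket s).
Proof.
apply: (measurableT_comp (measurable_powR _)); apply: measurable_funD => //.
rewrite (_ : @cnorm2 R = (fun z => cnorm2 (csub z (0, 0)))); last first.
  by apply/funext => z; rewrite csub0.
exact: measurable_cnorm2.
Qed.

Lemma bracket_le_shell_cnorm2 s z : 0 < s <= 1 / 2 -> z != (0, 0) ->
  bracket s z <= shell s (cnorm2 z).
Proof. by move=> hs z0; apply: bracket_le_shell => //; rewrite cnorm2_gt0. Qed.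

Lemma bracket_integral s : 0 < s <= 1 / 2 ->
  (\int[@leb2 R]_z (bracket s z)%:E <= (128 / s ^+ 2)%:E)%E.
Proof.
move=> hs; rewrite -[X in X%:E]mulr1.
apply: (@plane_integral_le_shell _ s (0, 0)) => //.
- exact: measurable_bracket.
- by move=> z; exact: bracket_ge0.
- move=> z z0 _; rewrite mul1r csub0.
  apply: le_trans (bracket_le_shell_cnorm2 hs z0) _.
  by rewrite lerDl shell_ge0.
Qed.

(** The factor of the volume bound carried by the coordinate [a]: in the chart |det q| = |a - bc|,
    so [z0] will be bc. *)
Definition singular s z0 z : R := bracket s z * cnorm2 (csub z z0) `^ (- (3 * s)).

Lemma singular_ge0 s z0 z : 0 <= singular s z0 z.
Proof. by rewrite mulr_ge0 ?powR_ge0. Qed.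

(** Away from [z0] (M >= 1) the singular power is at most 1. Near it (M < 1) the bracket is at most
    1 and M^(-3s) <= M^(s-1), which is where s <= 1/4 enters; there (1 + M)^(-2s) is at least 1/2,
    whence the factor 2. *)
Lemma singular_integral s z0 : 0 < s <= 1 / 4 ->
  (\int[@leb2 R]_z (singular s z0 z)%:E <= (128 / s ^+ 2 * 2)%:E)%E.
Proof.
move=> hs; have /andP[s0 s1] := hs.
have hs2 : 0 < s <= 1 / 2 by lra.
apply: (@plane_integral_le_shell _ s z0) => //.
- apply: measurable_funM; first exact: measurable_bracket.
  by apply: (measurableT_comp (measurable_powR _)); exact: measurable_cnorm2.
- by move=> z; exact: singular_ge0.
move=> z z1 z2; have M0 := cnorm2_csub_gt0 z2.
have N0 : 0 < cnorm2 z by rewrite cnorm2_gt0.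
rewrite /singular; set M := cnorm2 (csub z z0) in M0 *.
have hN := bracket_le_shell_cnorm2 hs2 z1.
have sM := shell_ge0 s M; have sN := shell_ge0 s (cnorm2 z).
have b0 := bracket_ge0 s z.
have [M1|M1] := leP 1 M.
  have M3 : M `^ (- (3 * s)) <= 1.
    by rewrite -[leRHS](powRr0 M); apply: ler_powR; lra.
  by have := ler_wpM2l b0 M3; lra.
have b1 : bracket s z <= 1.
  by rewrite -[leRHS](powRr0 (1 + cnorm2 z)); apply: ler_powR; lra.
have M3 : M `^ (- (3 * s)) <= 2 * shell s M.
  have h1 : M `^ (- (3 * s)) <= M `^ (s - 1).
    by apply: ger_powR; rewrite ?M0 ?(ltW M1)//; lra.
  have h2 : 1 <= 2 * (1 + M) `^ (- (2 * s)).
    have : (1 + M) `^ (- 1) <= (1 + M) `^ (- (2 * s)) by apply: ler_powR; lra.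
    rewrite powR_inv1; last by lra.
    have : 2^-1 <= (1 + M)^-1 by rewrite lef_pV2 ?posrE; lra.
    lra.
  rewrite /shell mulrCA -[leLHS]mulr1; apply: ler_pM; rewrite ?powR_ge0//.
have p0 := powR_ge0 M (- (3 * s)).
by have := ler_wpM2r p0 b1; lra.
Qed.

Lemma voldens_ge0 x : 0 <= voldens x.
Proof. by rewrite /voldens; case: ifP => _ //; exact: sqrtr_ge0. Qed.

(** The power of |q|^2 is shared equally among the three complex coordinates, each receiving the
    exponent -(1 + s), as |q|^2 exceeds each 1 + |.|^2. *)
Lemma voldens_le_product : exists2 C : R, 0 <= C & forall x,
  voldens x <= C * (singular (1 / 18) (cmul x.1.2 x.2) x.1.1 *
                    bracket (1 / 18) x.1.2 * bracket (1 / 18) x.2).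
Proof.
(* The value 1/18 solves 6s - 7/2 = -3 (1 + s). *)
have : exists2 s : R, 0 < s <= 1 / 2 & s = 1 / 18 by exists (1 / 18); lra.
move=> [s hs es]; rewrite -es; have [C C0 hC] := voldens_le hs.
exists C => // x; apply: le_trans (hC x) _; rewrite ler_wpM2l//.
have d : detsq (chart x) = cnorm2 (csub x.1.1 (cmul x.1.2 x.2)).
  by rewrite /detsq /chart /cnorm2 /=; ring.
rewrite /singular -d -!mulrA mulrCA mulrA mulrC -!mulrA [leRHS]mulrC.
rewrite mulrC [leRHS]mulrC.
have := powR_ge0 (detsq (chart x)) (- (3 * s)).
set D := _ `^ (- (3 * s)) => D0.
suff h : normsq (chart x) `^ (6 * s - 7 / 2) <=
    bracket s x.1.1 * (bracket s x.1.2 * bracket s x.2).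
  have := ler_wpM2r D0 h; lra.
have T1 z : cnorm2 z <= normsq (chart x) - 1 ->
    normsq (chart x) `^ (- (1 + s)) <= bracket s z.
  by move=> h; apply: powRNn_le; have := cnorm2_ge0 z; lra.
have n1 := cnorm2_ge0 x.1.1; have n2 := cnorm2_ge0 x.1.2; have n3 := cnorm2_ge0 x.2.
have e := normsq_chart x.
rewrite (_ : 6 * s - 7 / 2 = - (1 + s) + (- (1 + s) + - (1 + s))); last by rewrite es; field.
rewrite !powRD_gt0; [|lra|lra].
by do 2 (apply: ler_pM; rewrite ?mulr_ge0 ?powR_ge0//; first by apply: T1; lra); apply: T1; lra.
Qed.

Lemma volume_M1_finite : (volume_M1 R < +oo)%E.
Proof.
have [C C0 hC] := voldens_le_product.
have : exists2 s : R, 0 < s <= 1 / 4 & s = 1 / 18 by exists (1 / 18); lra.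
move=> [s hs es]; rewrite -es in hC; have /andP[s0 s1] := hs.
have hs2 : 0 < s <= 1 / 2 by lra.
pose K : R := 128 / s ^+ 2.
have K0 : 0 <= K by rewrite divr_ge0 ?sqr_ge0.
have hbr : (\int[@leb2 R]_z (bracket s z)%:E <= K%:E)%E := bracket_integral hs2.
have hsing z0 : (\int[@leb2 R]_z (singular s z0 z)%:E <= (K * 2)%:E)%E :=
  singular_integral z0 hs.
clearbody K.
pose f3 x := C * (singular s (cmul x.1.2 x.2) x.1.1 * bracket s x.1.2 * bracket s x.2).
have f30 x : 0 <= f3 x by rewrite /f3 !mulr_ge0 ?powR_ge0.
(* What is left once the first two variables are integrated out: [a] contributes [K * 2] and [b]
   contributes [K]. *)
pose f1 z := C * (K * 2) * K * bracket s z.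
pose leb2s := prod_sfm (@lebesgue_measure R) (@lebesgue_measure R).
(* The same measure by conversion, written with the product that is registered as sigma-finite. *)
have -> : volume_M1 R =
  (\int[(prod_sfm leb2s leb2s \x leb2s)%E]_x (voldens x)%:E)%E by [].
have mb : measurable_fun setT (bracket s) := measurable_bracket s.
have mf3 : measurable_fun setT f3.
  apply: measurable_funM => //; apply: measurable_funM; last first.
    by apply: (measurableT_comp mb).
  apply: measurable_funM; last first.
    by apply: (measurableT_comp mb); apply: (measurableT_comp measurable_snd).
  apply: measurable_funM.
    by apply: (measurableT_comp mb); apply: (measurableT_comp measurable_fst).
  apply: (measurableT_comp (measurable_powR _)).
  have m1 : measurable_fun setT (fun x => x.1.1.1).
    by apply: (measurableT_comp measurable_fst); apply: (measurableT_comp measurable_fst).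
  have m2 : measurable_fun setT (fun x => x.1.1.2).
    by apply: (measurableT_comp measurable_snd); apply: (measurableT_comp measurable_fst).
  have m3 : measurable_fun setT (fun x => x.1.2.1).
    by apply: (measurableT_comp measurable_fst); apply: (measurableT_comp measurable_snd).
  have m4 : measurable_fun setT (fun x => x.1.2.2).
    by apply: (measurableT_comp measurable_snd); apply: (measurableT_comp measurable_snd).
  have m5 : measurable_fun setT (fun x => x.2.1).
    exact: (measurableT_comp measurable_fst).
  have m6 : measurable_fun setT (fun x => x.2.2).
    exact: (measurableT_comp measurable_snd).
  rewrite /cnorm2 /csub /cmul /=.
  apply: measurable_funD; apply: measurable_funX; apply: measurable_funB => //.
    by apply: measurable_funB; apply: measurable_funM.
  by apply: measurable_funD; apply: measurable_funM.
apply: (@le_lt_trans _ _ (\int[leb2s]_z (f1 z)%:E)%E); last first.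
  rewrite /f1; under eq_integral do rewrite EFinM.
  rewrite ge0_integralZl_EFin//; last 3 first.
  - by move=> z _; rewrite lee_fin bracket_ge0.
  - exact/measurable_EFinP.
  - by do 2?[apply: mulr_ge0 => //]; exact: mulr_ge0.
  rewrite lte_mul_pinfty ?lee_fin//.
    by do 2?[apply: mulr_ge0 => //]; exact: mulr_ge0.
  by apply: le_lt_trans hbr _; rewrite ltry.
apply: (@triple_integral_le _ _ R leb2s (fun x => (voldens x)%:E) (fun x => (f3 x)%:E)
  (fun c b => (C * (K * 2) * bracket s c * bracket s b)%:E)).
- by move=> x; rewrite lee_fin; exact: voldens_ge0.
- by move=> x; rewrite lee_fin; exact: hC.
- exact/measurable_EFinP.
- move=> b c; rewrite /f3 /=.
  rewrite (_ : (fun a => _) = (fun a => (C * bracket s b * bracket s c)%:E *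
      (singular s (cmul b c) a)%:E)%E); last first.
    by apply/funext => a; rewrite -EFinM; congr EFin; ring.
  have Cbc : 0 <= C * bracket s b * bracket s c.
    by do 2?[apply: mulr_ge0 => //]; exact: bracket_ge0.
  rewrite ge0_integralZl_EFin//; last 2 first.
  + by move=> z _; rewrite lee_fin singular_ge0.
  + apply/measurable_EFinP; apply: measurable_funM => //.
    by apply: (measurableT_comp (measurable_powR _)); exact: measurable_cnorm2.
  apply: (@le_trans _ _ ((C * bracket s b * bracket s c)%:E * (K * 2)%:E)%E).
    by rewrite lee_wpmul2l ?lee_fin//; exact: hsing.
  by rewrite -EFinM lee_fin le_eqVlt; apply/orP; left; apply/eqP; ring.
- move=> c; under eq_integral do rewrite EFinM.
  have Cc : 0 <= C * (K * 2) * bracket s c.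
    by do 2?[apply: mulr_ge0 => //]; [exact: mulr_ge0|exact: bracket_ge0].
  rewrite ge0_integralZl_EFin//; last 2 first.
  + by move=> z _; rewrite lee_fin bracket_ge0.
  + exact/measurable_EFinP.
  apply: (@le_trans _ _ ((C * (K * 2) * bracket s c)%:E * K%:E)%E).
    by rewrite lee_wpmul2l ?lee_fin//; exact: hbr.
  by rewrite -EFinM lee_fin le_eqVlt; apply/orP; left; apply/eqP; rewrite /f1; ring.
Qed.

End VolumeIntegral.

(** * Polynomial curves *)

Section PolynomialCurves.
Variable R : realType.

(** Polynomial entries make the curves C^1 on the whole line, with derivatives computed formally. *)
Definition poly_curve (p : 'I_8 -> {poly R}) (t : R) : 'rV[R]_8 := \row_i (p i).[t].

Lemma derivable_poly_curve p t : derivable (poly_curve p) t 1.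
Proof.
apply/derivable_mxP => i j.
rewrite (_ : (fun x => _) = horner (p j)); first exact: derivable_horner.
by apply/funext => x; rewrite mxE.
Qed.

Lemma derive1_poly_curve p : derive1 (poly_curve p) = poly_curve (fun i => (p i)^`()).
Proof.
apply/funext => t; rewrite derive1E derive_mx; last exact: derivable_poly_curve.
apply/rowP => j; rewrite !mxE (_ : (fun x => _) = horner (p j)); last first.
  by apply/funext => x; rewrite mxE.
by rewrite -derive1E derivE.
Qed.

Lemma C1_poly_curve p : C1_curve (poly_curve p).
Proof.
split; first exact: derivable_poly_curve.
rewrite derive1_poly_curve => t.
exact/differentiable_continuous/derivable1_diffP/derivable_poly_curve.
Qed.

End PolynomialCurves.

(** * Quaternionic normal form *)

Section NormalForm.
Variable R : realType.
Implicit Types (x y w z l : cplx R) (q u : quad R).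

Definition cscale l q : quad R :=
  (cmul l (qa q), cmul l (qb q), cmul l (qc q), cmul l (qd q)).

(* The matrix [[x + X, y + Y], [Y^* - y^*, x^* - X^*]], i.e. [h + i k] with
   [h] and [k] quaternions, in the decomposition of the 2x2 complex matrices
   as the complexified quaternions. *)
Definition biquat x y w z : quad R :=
  ((x.1 + w.1, x.2 + w.2), (y.1 + z.1, y.2 + z.2),
   (z.1 - y.1, y.2 - z.2), (x.1 - w.1, w.2 - x.2)).

Lemma normsq_biquat x y w z :
  normsq (biquat x y w z) = 2 * (cnorm2 x + cnorm2 y + cnorm2 w + cnorm2 z).
Proof. by rewrite /normsq /biquat /cnorm2 /=; ring. Qed.

(** The right side of the hypothesis on [m] is the real part of the determinant, which is at most
    its modulus. *)
Lemma detsq_biquat_ge x y w z (m : R) : 0 <= m ->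
  m <= cnorm2 x + cnorm2 y - cnorm2 w - cnorm2 z ->
  m ^+ 2 <= detsq (biquat x y w z).
Proof.
move=> m0; set e := _ - cnorm2 z => me.
rewrite /detsq; set d := csub _ _.
have de : d.1 = e by rewrite /d /e /biquat /cnorm2 /csub /cmul /=; ring.
apply: (@le_trans _ _ (d.1 ^+ 2)); last by rewrite lerDl sqr_ge0.
by rewrite de ler_pXn2r ?nnegrE//; exact: le_trans me.
Qed.

Lemma cnorm2M x y : cnorm2 (cmul x y) = cnorm2 x * cnorm2 y.
Proof. by rewrite /cnorm2 /cmul /=; ring. Qed.

Lemma detsq_cscale l q : detsq (cscale l q) = cnorm2 l ^+ 2 * detsq q.
Proof. by rewrite /detsq /cscale /cnorm2 /csub /cmul /=; ring. Qed.

Lemma nondegP q : nondeg q <-> 0 < detsq q.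
Proof.
split; first exact: detsq_gt0.
by rewrite cnorm2_gt0 => /eqP.
Qed.

Lemma cscaleA l w q : cscale l (cscale w q) = cscale (cmul l w) q.
Proof. by rewrite /cscale /cmul /=; congr (_, _, _, _); congr (_, _); ring. Qed.

(** When Re det >= 0, |k| <= |h|, so h is nonzero (otherwise q = 0) and one divides by r = |h|. *)
Lemma biquat_normal_form q : nondeg q ->
  exists l x y w z, [/\ l != (0, 0), q = cscale l (biquat x y w z),
    cnorm2 x + cnorm2 y = 1 & cnorm2 w + cnorm2 z <= 1].
Proof.
have main u : 0 < detsq u ->
    0 <= (csub (cmul (qa u) (qd u)) (cmul (qb u) (qc u))).1 ->
    exists (r : R) x y w z, [/\ r != 0, u = cscale (r, 0) (biquat x y w z),
      cnorm2 x + cnorm2 y = 1 & cnorm2 w + cnorm2 z <= 1].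
  case: u => [[[[a1 a2] [b1 b2]] [c1 c2]] [d1 d2]] D0 redet.
  pose x : cplx R := ((a1 + d1) / 2, (a2 - d2) / 2).
  pose y : cplx R := ((b1 - c1) / 2, (b2 + c2) / 2).
  pose w : cplx R := ((a1 - d1) / 2, (a2 + d2) / 2).
  pose z : cplx R := ((b1 + c1) / 2, (b2 - c2) / 2).
  have hre : cnorm2 x + cnorm2 y - (cnorm2 w + cnorm2 z) = (a1 * d1 - a2 * d2) - (b1 * c1 - b2 * c2).
    by rewrite /cnorm2 /=; field.
  pose r := Num.sqrt (cnorm2 x + cnorm2 y).
  have xy0 : 0 <= cnorm2 x + cnorm2 y by rewrite addr_ge0 ?cnorm2_ge0.
  have wz0 : 0 <= cnorm2 w + cnorm2 z by rewrite addr_ge0 ?cnorm2_ge0.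
  have r2 : r ^+ 2 = cnorm2 x + cnorm2 y by rewrite sqr_sqrtr.
  have xyp : 0 < cnorm2 x + cnorm2 y.
    rewrite lt_neqAle xy0 andbT eq_sym; apply/negP => /eqP xy.
    have wz : cnorm2 w + cnorm2 z = 0.
      by apply/eqP; rewrite eq_le wz0 andbT; move: redet; rewrite /= -hre xy; lra.
    have Z (v : cplx R) : cnorm2 v = 0 -> v.1 = 0 /\ v.2 = 0.
      by move/eqP; rewrite cnorm2_eq0 => /eqP ->.
    have [x1 x2] : x.1 = 0 /\ x.2 = 0.
      by apply: Z; have := cnorm2_ge0 x; have := cnorm2_ge0 y; lra.
    have [y1 y2] : y.1 = 0 /\ y.2 = 0.
      by apply: Z; have := cnorm2_ge0 x; have := cnorm2_ge0 y; lra.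
    have [w1 w2] : w.1 = 0 /\ w.2 = 0.
      by apply: Z; have := cnorm2_ge0 w; have := cnorm2_ge0 z; lra.
    have [z1 z2] : z.1 = 0 /\ z.2 = 0.
      by apply: Z; have := cnorm2_ge0 w; have := cnorm2_ge0 z; lra.
    rewrite /= in x1 x2 y1 y2 w1 w2 z1 z2.
    have [A1 A2] : a1 = 0 /\ a2 = 0 by lra.
    have [B1 B2] : b1 = 0 /\ b2 = 0 by lra.
    have [C1 C2] : c1 = 0 /\ c2 = 0 by lra.
    move: D0; rewrite /detsq /cnorm2 /csub /cmul /= A1 A2 B1 B2 C1 C2.
    by rewrite (_ : _ + _ = 0) ?ltxx//; ring.
  have r0 : r != 0 by rewrite gt_eqF// sqrtr_gt0.
  have sc (v : cplx R) : cnorm2 (v.1 / r, v.2 / r) = cnorm2 v / r ^+ 2.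
    by rewrite /cnorm2 /=; field.
  exists r, (x.1 / r, x.2 / r), (y.1 / r, y.2 / r), (w.1 / r, w.2 / r), (z.1 / r, z.2 / r).
  split => //.
  - rewrite /cscale /biquat /cmul /=.
    by congr (_, _, _, _); congr (_, _); field.
  - by rewrite !sc -mulrDl r2 divff// gt_eqF.
  - rewrite !sc -mulrDl r2 ler_pdivrMr// mul1r.
    by move: redet; rewrite /= -hre; lra.
move=> /detsq_gt0 D0.
pose re u := (csub (cmul (qa u) (qd u)) (cmul (qb u) (qc u))).1 : R.
have [h|h] := leP 0 (re q).
  have [r [x [y [w [z [r0 e n1 n2]]]]]] := main q D0 h.
  exists (r, 0), x, y, w, z; split => //.
  by apply: contra r0 => /eqP[->].
(* If Re det < 0, multiplying q by -i changes the sign of the determinant; the factor i is restored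
   in the scalar. *)
have D1 : 0 < detsq (cscale (0, -1) q).
  by rewrite detsq_cscale mulr_gt0// exprn_gt0// /cnorm2 /=; lra.
have h1 : 0 <= re (cscale (0, -1) q).
  rewrite (_ : re _ = - re q); first by rewrite oppr_ge0 ltW.
  by rewrite /re /cscale /csub /cmul /=; ring.
have [r [x [y [w [z [r0 e n1 n2]]]]]] := main _ D1 h1.
exists (0, r), x, y, w, z; split => //.
  by apply: contra r0 => /eqP[->].
have -> : (0, r) = cmul (0, 1) (r, 0) :> cplx R.
  by rewrite /cmul /=; congr (_, _); ring.
rewrite -cscaleA -e cscaleA.
case: q {D0 re h D1 h1 e} => [[[[a1 a2] [b1 b2]] [c1 c2]] [d1 d2]].
by rewrite /cscale /cmul /=; congr (_, _, _, _); congr (_, _); ring.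
Qed.

(** The segment from [l] to [m] may cross 0, so it is bent along e = i l or -i l. With the sign [s]
    of the cross product [c] of [l] and [m], the cross product of [l] with the path, times [s], is t
    |c| + t (1-t) |l|^2, positive for 0 < t < 1. *)
Lemma cplx_path_neq0 (l m : cplx R) : l != (0, 0) -> m != (0, 0) ->
  exists e : cplx R, forall t : R, 0 <= t <= 1 ->
    ((1 - t) * l.1 + t * m.1 + t * (1 - t) * e.1,
     (1 - t) * l.2 + t * m.2 + t * (1 - t) * e.2) != (0, 0).
Proof.
rewrite -!cnorm2_gt0 => l0 m0.
pose c := l.1 * m.2 - l.2 * m.1.
pose s : R := if 0 <= c then 1 else -1.
exists (- (s * l.2), s * l.1) => t /andP[t0 t1]; apply/eqP => -[h1 h2].
have := congr1 (fun a => s * (l.1 * a)) h2; have := congr1 (fun a => s * (l.2 * a)) h1.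
rewrite /= !mulr0 => e1 e2.
have s2 : s * s = 1 by rewrite /s; case: ifP => _; ring.
have sc : 0 <= s * c by rewrite /s; case: ifP => [|/negbT]; rewrite -?ltNge; lra.
have key : t * (s * c) + t * (1 - t) * cnorm2 l = 0.
  have E : s * (l.1 * ((1 - t) * l.2 + t * m.2 + t * (1 - t) * (s * l.1))) -
     s * (l.2 * ((1 - t) * l.1 + t * m.1 + t * (1 - t) * (- (s * l.2)))) =
     t * (s * c) + t * (1 - t) * (s * s) * cnorm2 l by rewrite /c /cnorm2; ring.
  by move: E; rewrite e1 e2 s2 subrr mulr1 => <-.
have tt : 0 <= t * (1 - t) by rewrite mulr_ge0//; lra.
have p1 : 0 <= t * (s * c) by rewrite mulr_ge0.
have p2 : 0 <= t * (1 - t) * cnorm2 l by rewrite mulr_ge0// ltW.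
have : t * (1 - t) * cnorm2 l = 0 by lra.
move/eqP; rewrite mulf_eq0 (gt_eqF l0) orbF mulf_eq0 => /orP[] /eqP te.
  move: h1 h2; rewrite te subr0 !mul0r !mul1r !addr0 => h1 h2.
  by move: l0; rewrite /cnorm2 h1 h2 expr0n/= addr0 ltxx.
move: h1 h2; rewrite te (_ : t = 1); last by lra.
rewrite !mul1r !mul0r !addr0 !add0r => h1 h2.
by move: m0; rewrite /cnorm2 h1 h2 expr0n/= addr0 ltxx.
Qed.

(* [v] is the velocity of a lift [l q] with [l] a nonvanishing scalar function
   and [q] of velocity [u]. *)
Lemma gammaL2_rescale (l l' : cplx R) q u : l != (0, 0) ->
  let v : quad R := (Defs.cadd (cmul l' (qa q)) (cmul l (qa u)),
    Defs.cadd (cmul l' (qb q)) (cmul l (qb u)),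
    Defs.cadd (cmul l' (qc q)) (cmul l (qc u)),
    Defs.cadd (cmul l' (qd q)) (cmul l (qd u))) in
  gammaL2 (cscale l q) v v = gammaL2 q u u.
Proof.
rewrite -cnorm2_gt0 => l0 /=.
rewrite /gammaL2; congr Rintegral; apply/funext => z; congr (_ * _).
rewrite (_ : Den (cscale l q) z = cnorm2 l * Den q z); last first.
  by rewrite /Den /cscale /cnorm2 /Defs.cadd /cmul /=; ring.
rewrite !cdotxx.
(* The contribution of [l'] is a multiple of [Nv q q z], which is 0. *)
rewrite [Nv (cscale _ _) _ _](_ : _ = cmul (cmul l l) (Nv q u z)).
  rewrite !cnorm2M -expr2 exprMn invfM mulrACA divff ?mul1r//.
  by rewrite expf_neq0// gt_eqF.
by rewrite /Nv /cscale /csub /Defs.cadd /cmul /=; congr (_, _); ring.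
Qed.

End NormalForm.

(** * Finite diameter *)

Section Diameter.
Variable R : realType.
Implicit Types (l x y w z : cplx R) (q u : quad R) (p : {poly R}).

Definition list_curve (s : seq {poly R}) (i : 'I_8) : {poly R} := nth 0 s i.

Section PolynomialInterpolation.
Variables (P : {poly R}) (a b e t : R).

Definition plin : {poly R} := (1%:P - P) * a%:P + P * b%:P.
Definition pquad : {poly R} := (1%:P - P) * (1%:P - P) * a%:P + P * P * b%:P.
Definition pbump : {poly R} := plin + P * (1%:P - P) * e%:P.

Let hE := (hornerD, hornerN, hornerM, hornerC).
Let dE := (poly.derivD, poly.derivN, poly.derivM, poly.derivC).

Lemma horner_plin : plin.[t] = (1 - P.[t]) * a + P.[t] * b.
Proof. by rewrite /plin !hE. Qed.

Lemma deriv_plin : plin^`().[t] = P^`().[t] * (b - a).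
Proof. by rewrite /plin !dE !hE; ring. Qed.

Lemma horner_pquad : pquad.[t] = (1 - P.[t]) ^+ 2 * a + P.[t] ^+ 2 * b.
Proof. by rewrite /pquad !hE; ring. Qed.

Lemma deriv_pquad : pquad^`().[t] = P^`().[t] * (2 * (P.[t] * b - (1 - P.[t]) * a)).
Proof. by rewrite /pquad !dE !hE; ring. Qed.

Lemma horner_pbump : pbump.[t] =
  (1 - P.[t]) * a + P.[t] * b + P.[t] * (1 - P.[t]) * e.
Proof. by rewrite /pbump hornerD horner_plin !hE. Qed.

End PolynomialInterpolation.

(* The time change [3 t^2 - 2 t^3] is flat at both ends: this absorbs the
   blow-up of the speed bound when an endpoint is nearly degenerate. *)
Definition ptime : {poly R} := 'X * 'X * (3%:P - 2%:P * 'X).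

Lemma horner_ptime t : ptime.[t] = t ^+ 2 * (3 - 2 * t).
Proof. by rewrite /ptime !(hornerD, hornerN, hornerM, hornerC, hornerX); ring. Qed.

Lemma deriv_ptime t : ptime^`().[t] = 6 * (t * (1 - t)).
Proof.
rewrite /ptime !(poly.derivD, poly.derivN, poly.derivM, poly.derivC, poly.derivX).
by rewrite !(hornerD, hornerN, hornerM, hornerC, hornerX); ring.
Qed.

(** With T the time change, T >= t^2, and 1 - T = (1-t)^2 (1 + 2t) >= (1-t)^2. *)
Lemma ptime_bounds t : 0 <= t <= 1 ->
  0 <= ptime.[t] <= 1 /\ (t * (1 - t)) ^+ 2 <= ptime.[t] * (1 - ptime.[t]).
Proof.
move=> /andP[t0 t1]; rewrite horner_ptime.
have e : 1 - t ^+ 2 * (3 - 2 * t) = (1 - t) ^+ 2 * (1 + 2 * t) by ring.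
have a0 : t ^+ 2 <= t ^+ 2 * (3 - 2 * t).
  by rewrite -[leLHS]mulr1 ler_wpM2l ?sqr_ge0//; lra.
have b0 : (1 - t) ^+ 2 <= 1 - t ^+ 2 * (3 - 2 * t).
  by rewrite e -[leLHS]mulr1 ler_wpM2l ?sqr_ge0//; lra.
have s1 := sqr_ge0 t; have s2 := sqr_ge0 (1 - t).
split; first by apply/andP; split; lra.
by rewrite exprMn; apply: ler_pM.
Qed.

(** The part h of the path uses linear weights and the part k squared weights; [dclin] and [dcsq]
    are the velocities when the parameter moves at rate [d]. *)
Definition clin (t : R) v v' : cplx R :=
  ((1 - t) * v.1 + t * v'.1, (1 - t) * v.2 + t * v'.2).
Definition csq (t : R) v v' : cplx R :=
  ((1 - t) ^+ 2 * v.1 + t ^+ 2 * v'.1, (1 - t) ^+ 2 * v.2 + t ^+ 2 * v'.2).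
Definition dclin (d : R) v v' : cplx R := (d * (v'.1 - v.1), d * (v'.2 - v.2)).
Definition dcsq (d t : R) v v' : cplx R :=
  (d * (2 * (t * v'.1 - (1 - t) * v.1)), d * (2 * (t * v'.2 - (1 - t) * v.2))).

(** Put g = t (1-t). Then |h|^2 >= (1-t)^2 + t^2 = 1 - 2g, as the inner product is nonnegative,
    while the squared weights give |k| <= 1 - 2g. Hence Re det >= (1 - 2g) - (1 - 2g)^2 = g + g (1 -
    4g) >= g, since g <= 1/4. *)
Lemma path_det_lower (x y w z x' y' w' z' : cplx R) (t : R) : 0 <= t <= 1 ->
  cnorm2 x + cnorm2 y = 1 -> cnorm2 w + cnorm2 z <= 1 ->
  cnorm2 x' + cnorm2 y' = 1 -> cnorm2 w' + cnorm2 z' <= 1 ->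
  0 <= cdot x x' + cdot y y' ->
  t * (1 - t) <= cnorm2 (clin t x x') + cnorm2 (clin t y y')
                 - cnorm2 (csq t w w') - cnorm2 (csq t z z').
Proof.
move=> /andP[t0 t1] n1 n2 n1' n2' ip; pose lin := clin t; pose sq := csq t.
have tt : 0 <= t * (1 - t) by rewrite mulr_ge0//; lra.
have E1 : cnorm2 (lin x x') + cnorm2 (lin y y') =
    (1 - t) ^+ 2 * (cnorm2 x + cnorm2 y) + t ^+ 2 * (cnorm2 x' + cnorm2 y') +
    2 * (t * (1 - t)) * (cdot x x' + cdot y y').
  by rewrite /lin /clin /cnorm2 /cdot /=; ring.
pose i2 := cdot w w' + cdot z z'.
have i2le : 2 * i2 <= cnorm2 w + cnorm2 z + (cnorm2 w' + cnorm2 z').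
  rewrite -subr_ge0 (_ : _ - _ = cnorm2 (csub w w') + cnorm2 (csub z z')).
    by rewrite addr_ge0 ?cnorm2_ge0.
  by rewrite /i2 /cnorm2 /cdot /csub /=; ring.
have E2 : cnorm2 (sq w w') + cnorm2 (sq z z') =
    (1 - t) ^+ 2 * (1 - t) ^+ 2 * (cnorm2 w + cnorm2 z) + t ^+ 2 * t ^+ 2 * (cnorm2 w' + cnorm2 z') +
    (t * (1 - t)) ^+ 2 * (2 * i2).
  by rewrite /sq /csq /i2 /cnorm2 /cdot /=; ring.
have a0 := sqr_ge0 (1 - t); have b0 := sqr_ge0 t.
have h1 : (1 - t) ^+ 2 * (1 - t) ^+ 2 * (cnorm2 w + cnorm2 z) <= (1 - t) ^+ 2 * (1 - t) ^+ 2.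
  by rewrite -[leRHS]mulr1 ler_wpM2l// mulr_ge0.
have h2 : t ^+ 2 * t ^+ 2 * (cnorm2 w' + cnorm2 z') <= t ^+ 2 * t ^+ 2.
  by rewrite -[leRHS]mulr1 ler_wpM2l// mulr_ge0.
have h3 : (t * (1 - t)) ^+ 2 * (2 * i2) <= (t * (1 - t)) ^+ 2 * 2.
  by rewrite ler_wpM2l ?sqr_ge0//; lra.
have h4 : 0 <= 2 * (t * (1 - t)) * (cdot x x' + cdot y y').
  by rewrite mulr_ge0// mulr_ge0.
have g : (1 - t) ^+ 2 + t ^+ 2 = 1 - 2 * (t * (1 - t)) by ring.
have g2 : (1 - t) ^+ 2 * (1 - t) ^+ 2 + t ^+ 2 * t ^+ 2 + (t * (1 - t)) ^+ 2 * 2 = (1 - 2 * (t * (1 - t))) ^+ 2.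
  by ring.
have q : t * (1 - t) <= 1 / 4.
  by have := sqr_ge0 (t - 1 / 2); nra.
rewrite -addrA -opprD -/lin -/sq E2 E1 n1 n1' !mulr1 g.
have -> : t * (1 - t) = (1 - 2 * (t * (1 - t))) - (1 - 2 * (t * (1 - t))) ^+ 2 - t * (1 - t) * (1 - 4 * (t * (1 - t))).
  by ring.
have : 0 <= t * (1 - t) * (1 - 4 * (t * (1 - t))) by rewrite mulr_ge0//; lra.
by lra.
Qed.

(** The constant is 40 = 2 (4 + 16): 4 for the velocity of h, 16 for that of k, doubled by
    [normsq_biquat]. *)
Lemma path_speed_upper (x y w z x' y' w' z' : cplx R) (t d : R) : 0 <= t <= 1 ->
  cnorm2 x + cnorm2 y = 1 -> cnorm2 w + cnorm2 z <= 1 ->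
  cnorm2 x' + cnorm2 y' = 1 -> cnorm2 w' + cnorm2 z' <= 1 ->
  normsq (biquat (dclin d x x') (dclin d y y') (dcsq d t w w') (dcsq d t z z'))
    <= 40 * d ^+ 2.
Proof.
move=> /andP[t0 t1] n1 n2 n1' n2'; rewrite normsq_biquat.
pose lin := dclin d; pose sq := dcsq d t.
have L (v v' : cplx R) : cnorm2 (lin v v') <= d ^+ 2 * (2 * (cnorm2 v + cnorm2 v')).
  rewrite (_ : cnorm2 _ = d ^+ 2 * cnorm2 (csub v' v)); last first.
    by rewrite /lin /dclin /cnorm2 /csub /=; ring.
  rewrite ler_wpM2l ?sqr_ge0// -subr_ge0 (_ : _ - _ = cnorm2 (Defs.cadd v v')) ?cnorm2_ge0//.
  by rewrite /cnorm2 /csub /Defs.cadd /=; ring.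
have S (v v' : cplx R) : cnorm2 (sq v v') <= d ^+ 2 * (8 * (cnorm2 v + cnorm2 v')).
  pose a : cplx R := (t * v'.1, t * v'.2); pose b : cplx R := ((1 - t) * v.1, (1 - t) * v.2).
  rewrite (_ : cnorm2 _ = d ^+ 2 * (4 * cnorm2 (csub a b))); last first.
    by rewrite /sq /dcsq /a /b /cnorm2 /csub /=; ring.
  rewrite ler_wpM2l ?sqr_ge0//.
  have : cnorm2 (csub a b) <= 2 * (cnorm2 a + cnorm2 b).
    rewrite -subr_ge0 (_ : _ - _ = cnorm2 (Defs.cadd a b)) ?cnorm2_ge0//.
    by rewrite /cnorm2 /csub /Defs.cadd /=; ring.
  have sh (r : R) (c : cplx R) : 0 <= r <= 1 -> cnorm2 (r * c.1, r * c.2) <= cnorm2 c.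
    move=> /andP[r0 r1]; rewrite (_ : cnorm2 _ = r ^+ 2 * cnorm2 c); last first.
      by rewrite /cnorm2 /=; ring.
    by rewrite -[leRHS]mul1r ler_wpM2r ?cnorm2_ge0// expr_le1.
  have t01 : 0 <= t <= 1 by apply/andP; split.
  have t10 : 0 <= 1 - t <= 1 by apply/andP; split; lra.
  have := sh t v' t01; have := sh (1 - t) v t10; rewrite -/a -/b; lra.
rewrite -/lin -/sq; have := L x x'; have := L y y'; have := S w w'; have := S z z'.
have d0 := sqr_ge0 d.
have := ler_wpM2l d0 n2; have := ler_wpM2l d0 n2'.
have := congr1 (fun a => d ^+ 2 * a) n1; have := congr1 (fun a => d ^+ 2 * a) n1'.
rewrite /=; move: (cnorm2 (lin x x')) (cnorm2 (lin y y')) (cnorm2 (sq w w')).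
move: (cnorm2 (sq z z')) (d ^+ 2) => A D B C E; rewrite !mulrDr !mulr1; lra.
Qed.

Section RescaledCurve.
Variables L1 L2 X1 X2 Y1 Y2 W1 W2 Z1 Z2 : {poly R}.

(** Real and imaginary parts of the four entries of (L1 + i L2) times the biquaternion with parts X,
    Y, W, Z. *)
Definition rescaled_curve : R -> 'rV[R]_8 := poly_curve (list_curve
  [:: L1 * (X1 + W1) - L2 * (X2 + W2); L1 * (X2 + W2) + L2 * (X1 + W1);
      L1 * (Y1 + Z1) - L2 * (Y2 + Z2); L1 * (Y2 + Z2) + L2 * (Y1 + Z1);
      L1 * (Z1 - Y1) - L2 * (Y2 - Z2); L1 * (Y2 - Z2) + L2 * (Z1 - Y1);
      L1 * (X1 - W1) - L2 * (W2 - X2); L1 * (W2 - X2) + L2 * (X1 - W1)]).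

Definition rescaled_base (t : R) : quad R :=
  biquat (X1.[t], X2.[t]) (Y1.[t], Y2.[t]) (W1.[t], W2.[t]) (Z1.[t], Z2.[t]).

Definition rescaled_dbase (t : R) : quad R :=
  biquat (X1^`().[t], X2^`().[t]) (Y1^`().[t], Y2^`().[t])
         (W1^`().[t], W2^`().[t]) (Z1^`().[t], Z2^`().[t]).

Lemma rescaled_curveE t :
  quad_of (rescaled_curve t) = cscale (L1.[t], L2.[t]) (rescaled_base t).
Proof.
rewrite /rescaled_curve /quad_of /poly_curve /list_curve !mxE !inordK//=.
by rewrite !(hornerD, hornerN, hornerM) /cscale /rescaled_base /biquat /cmul.
Qed.

Lemma derive1_rescaled_curveE t :
  let l : cplx R := (L1.[t], L2.[t]) in
  let l' : cplx R := (L1^`().[t], L2^`().[t]) in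
  let q := rescaled_base t in let u := rescaled_dbase t in
  quad_of (derive1 rescaled_curve t) =
    (Defs.cadd (cmul l' (qa q)) (cmul l (qa u)), Defs.cadd (cmul l' (qb q)) (cmul l (qb u)),
     Defs.cadd (cmul l' (qc q)) (cmul l (qc u)), Defs.cadd (cmul l' (qd q)) (cmul l (qd u))).
Proof.
rewrite /rescaled_curve derive1_poly_curve /quad_of /poly_curve /list_curve !mxE !inordK//=.
rewrite !(poly.derivD, poly.derivN, poly.derivM) !(hornerD, hornerN, hornerM).
rewrite /rescaled_base /rescaled_dbase /biquat /cmul /Defs.cadd /=.
by congr (_, _, _, _); congr (_, _); ring.
Qed.

End RescaledCurve.

(** * A curve of bounded length between two normal forms *)

Section Joining.
Variables (x y w z x' y' w' z' l l' e : cplx R).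
Hypotheses (n1 : cnorm2 x + cnorm2 y = 1) (n2 : cnorm2 w + cnorm2 z <= 1).
Hypotheses (n1' : cnorm2 x' + cnorm2 y' = 1) (n2' : cnorm2 w' + cnorm2 z' <= 1).
Hypothesis ip : 0 <= cdot x x' + cdot y y'.
Hypothesis path_neq0 : forall t : R, 0 <= t <= 1 ->
  ((1 - t) * l.1 + t * l'.1 + t * (1 - t) * e.1,
   (1 - t) * l.2 + t * l'.2 + t * (1 - t) * e.2) != (0, 0).
Hypothesis p_nondeg : nondeg (cscale l (biquat x y w z)).
Hypothesis q_nondeg : nondeg (cscale l' (biquat x' y' w' z')).

Let T := ptime.
Let X1 := plin T x.1 x'.1. Let X2 := plin T x.2 x'.2.
Let Y1 := plin T y.1 y'.1. Let Y2 := plin T y.2 y'.2.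
Let W1 := pquad T w.1 w'.1. Let W2 := pquad T w.2 w'.2.
Let Z1 := pquad T z.1 z'.1. Let Z2 := pquad T z.2 z'.2.
Let L1 := pbump T l.1 l'.1 e.1. Let L2 := pbump T l.2 l'.2 e.2.

Let curve := rescaled_curve L1 L2 X1 X2 Y1 Y2 W1 W2 Z1 Z2.

Let lam (t : R) : cplx R := (L1.[t], L2.[t]).
Let base (t : R) : quad R := biquat (clin T.[t] x x') (clin T.[t] y y')
  (csq T.[t] w w') (csq T.[t] z z').
Let base' (t : R) : quad R := biquat (dclin T^`().[t] x x') (dclin T^`().[t] y y')
  (dcsq T^`().[t] T.[t] w w') (dcsq T^`().[t] T.[t] z z').

Let baseE (t : R) : rescaled_base X1 X2 Y1 Y2 W1 W2 Z1 Z2 t = base t.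
Proof. by rewrite /rescaled_base !horner_plin !horner_pquad. Qed.

Let dbaseE (t : R) : rescaled_dbase X1 X2 Y1 Y2 W1 W2 Z1 Z2 t = base' t.
Proof. by rewrite /rescaled_dbase !deriv_plin !deriv_pquad. Qed.

Let curveE (t : R) : quad_of (curve t) = cscale (lam t) (base t).
Proof. by rewrite /curve rescaled_curveE baseE. Qed.

Let lam_neq0 (t : R) : 0 <= t <= 1 -> lam t != (0, 0).
Proof.
move=> t01; rewrite /lam /L1 /L2 !horner_pbump.
by apply: path_neq0; have [] := ptime_bounds t01.
Qed.

(** The metric does not see the scalar [lam], so joining the arbitrary scalars of the endpoints adds
    no length. *)
Let curve_speedE (t : R) : 0 <= t <= 1 ->
  gammaL2 (quad_of (curve t)) (quad_of (derive1 curve t)) (quad_of (derive1 curve t)) =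
  gammaL2 (base t) (base' t) (base' t).
Proof.
move=> t01; rewrite /curve rescaled_curveE derive1_rescaled_curveE gammaL2_rescale.
  by rewrite baseE dbaseE.
exact: lam_neq0.
Qed.

Let T0 : T.[0] = 0. Proof. by rewrite /T horner_ptime expr0n mul0r. Qed.
Let T1 : T.[1] = 1. Proof. by rewrite /T horner_ptime; ring. Qed.

Let clin0 (v v' : cplx R) : clin 0 v v' = v.
Proof. by rewrite /clin subr0 !mul1r !mul0r !addr0 -surjective_pairing. Qed.
Let clin1 (v v' : cplx R) : clin 1 v v' = v'.
Proof. by rewrite /clin subrr !mul1r !mul0r !add0r -surjective_pairing. Qed.
Let csq0 (v v' : cplx R) : csq 0 v v' = v.
Proof. by rewrite /csq subr0 expr1n expr0n !mul1r !mul0r !addr0 -surjective_pairing. Qed.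
Let csq1 (v v' : cplx R) : csq 1 v v' = v'.
Proof. by rewrite /csq subrr expr1n expr0n !mul1r !mul0r !add0r -surjective_pairing. Qed.

Let curve0 : quad_of (curve 0) = cscale l (biquat x y w z).
Proof.
rewrite curveE /base T0 !clin0 !csq0; congr cscale.
rewrite /lam /L1 /L2 !horner_pbump T0 subr0 !mul1r !mul0r !addr0.
by rewrite -surjective_pairing.
Qed.

Let curve1 : quad_of (curve 1) = cscale l' (biquat x' y' w' z').
Proof.
rewrite curveE /base T1 !clin1 !csq1; congr cscale.
rewrite /lam /L1 /L2 !horner_pbump T1 subrr !mul1r !mul0r !add0r ?mulr0 ?mul0r ?addr0.
by rewrite -surjective_pairing.
Qed.

Let base_det (t : R) : 0 <= t <= 1 -> ((t * (1 - t)) ^+ 2) ^+ 2 <= detsq (base t).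
Proof.
move=> t01; have [T01 Tm] := ptime_bounds t01.
apply: detsq_biquat_ge; first exact: sqr_ge0.
apply: le_trans Tm _.
exact: path_det_lower.
Qed.

Let curve_nondeg (t : R) : 0 <= t <= 1 -> nondeg (quad_of (curve t)).
Proof.
move=> t01; have /andP[t0 t1] := t01.
(* The lower bound on the determinant is 0 at the endpoints; there nondegeneracy comes from the
   given points. *)
have [->|tn0] := eqVneq t 0; first by rewrite curve0.
have [->|tn1] := eqVneq t 1; first by rewrite curve1.
rewrite curveE nondegP detsq_cscale mulr_gt0//.
  by rewrite exprn_gt0// cnorm2_gt0 lam_neq0.
apply: lt_le_trans (base_det t01); rewrite !exprn_gt0//.
by rewrite mulr_gt0 ?subr_gt0// lt_neqAle ?tn1// eq_sym tn0.
Qed.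

Let base_nondeg (t : R) : 0 <= t <= 1 -> 0 < detsq (base t).
Proof.
move=> t01; have /nondegP := curve_nondeg t01.
by rewrite curveE detsq_cscale pmulr_rgt0// exprn_gt0// cnorm2_gt0 lam_neq0.
Qed.

(** At s = 1/2 the power of |q| disappears. With m = (t (1-t))^2, the squared velocity is at most 40
    * 36 m = 1440 m and |det|^(-1) is at most 1/m, so the time change makes the bound uniform. *)
Let speed (t : R) : 0 <= t <= 1 ->
  gammaL2 (quad_of (curve t)) (quad_of (derive1 curve t)) (quad_of (derive1 curve t))
    <= gamma_cst (1 / 2 : R) * 1440.
Proof.
move=> t01; rewrite curve_speedE//.
have bn := base_nondeg t01.
have hs : (0 < (1 / 2 : R)) && ((1 / 2 : R) <= 1 / 2) by lra.
apply: le_trans (gammaL2_le (base' t) hs _) _; first exact/nondegP.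
rewrite -mulrA ler_wpM2l ?gamma_cst_ge0//.
have -> : 2 * (1 / 2) - 1 = 0 :> R by field.
rewrite powRr0 mul1r.
have [T01 _] := ptime_bounds t01.
have up := path_speed_upper (T^`().[t]) T01 n1 n2 n1' n2'.
have m0 : 0 <= (t * (1 - t)) ^+ 2 by exact: sqr_ge0.
have dm := base_det t01.
have T36 : T^`().[t] ^+ 2 = 36 * (t * (1 - t)) ^+ 2.
  by rewrite /T deriv_ptime exprMn; ring.
move: ((t * (1 - t)) ^+ 2 : R) m0 dm T36 => m m0 dm T36.
have up2 : normsq (base' t) <= 1440 * m.
  by apply: le_trans up _; rewrite T36; lra.
(* At the endpoints, where 1/m is useless, the velocity of the time change is 0. *)
have [m00|mn0] := eqVneq m 0.
  have -> : normsq (base' t) = 0.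
    by apply/eqP; rewrite eq_le normsq_ge0 andbT; rewrite m00 in up2; lra.
  by rewrite mul0r; exact: ler0n.
have mp : 0 < m by rewrite lt_neqAle eq_sym mn0.
have Dm : detsq (base t) `^ (- (1 / 2)) <= m^-1.
  apply: (@le_trans _ _ ((m ^+ 2) `^ (- (1 / 2)))).
    by apply: powRNn_le; [exact: exprn_gt0|exact: dm|lra].
  rewrite -powR_mulrn ?(ltW mp)// -powRrM (_ : 2%:R * - (1 / 2) = -1); last by field.
  by rewrite powR_inv1// ltW.
apply: (@le_trans _ _ (1440 * m * m^-1)).
  by apply: ler_pM; rewrite ?normsq_ge0 ?powR_ge0.
by rewrite mulfK// gt_eqF.
Qed.

Lemma biquat_joinable : joinable_within (Num.sqrt (gamma_cst (1 / 2 : R) * 1440))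
  (cscale l (biquat x y w z)) (cscale l' (biquat x' y' w' z')).
Proof.
exists curve; split => //; first exact: C1_poly_curve.
set D := Num.sqrt _.
apply: (@le_trans _ _ (\int[@lebesgue_measure R]_(t in `[0%R, 1%R]%classic) D%:E)%E).
  apply: integral_ge0_mono => t /=; first by move=> _; rewrite lee_fin sqrtr_ge0.
  rewrite in_itv/= => t01; rewrite lee_fin /D ler_wsqrtr//.
  exact: speed.
rewrite integral_cst//= lebesgue_measure_itv/= lte_fin ltr01.
by rewrite -EFinD subr0 mule1.
Qed.

End Joining.

Lemma cscale_biquat_opp l x y w z : cscale (- l.1, - l.2)
    (biquat (- x.1, - x.2) (- y.1, - y.2) (- w.1, - w.2) (- z.1, - z.2)) =
  cscale l (biquat x y w z).
Proof.
case: l x y w z => [l1 l2] [x1 x2] [y1 y2] [w1 w2] [z1 z2].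
rewrite /cscale /biquat /cmul /=.
by congr (_, _, _, _); congr (_, _); ring.
Qed.

Lemma finite_diameter : finite_diameter_M1 R.
Proof.
exists (Num.sqrt (gamma_cst (1 / 2 : R) * 1440)) => p q np nq.
have [l [x [y [w [z [l0 pE n1 n2]]]]]] := biquat_normal_form np.
have [m [x' [y' [w' [z' [m0 qE n1' n2']]]]]] := biquat_normal_form nq.
pose opp (v : cplx R) : cplx R := (- v.1, - v.2).
have oppN v : cnorm2 (opp v) = cnorm2 v by rewrite /opp /cnorm2 /= !sqrrN.
(* Negating the scalar together with h and k leaves the matrix unchanged and reverses the sign of
   the inner product with the first point. *)
have qE' : q = cscale (opp m) (biquat (opp x') (opp y') (opp w') (opp z')).
  by rewrite qE cscale_biquat_opp.
have m0' : opp m != (0, 0) by rewrite -cnorm2_gt0 oppN cnorm2_gt0.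
have [ip|ip] := leP 0 (cdot x x' + cdot y y').
  have [e he] := cplx_path_neq0 l0 m0.
  rewrite pE qE; apply: (biquat_joinable (e := e)) => //; first by rewrite -pE.
  by rewrite -qE.
have [e he] := cplx_path_neq0 l0 m0'.
rewrite pE qE'; apply: (biquat_joinable (e := e)) => //.
- by rewrite !oppN.
- by rewrite !oppN.
- by move: ip; rewrite /cdot /opp /=; lra.
- by rewrite -pE.
- by rewrite -qE'.
Qed.

End Diameter.

Theorem theorem3p3 (R : realType) :
  (volume_M1 R < +oo)%E /\ finite_diameter_M1 R.
Proof. by split; [exact: volume_M1_finite|exact: finite_diameter]. Qed.
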